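(* Let $\alpha\in[0,\pi/2)$, $A\in\Pi^n_{s,\alpha}$, $q\in\mathbb{C}$ with $0<|q|\le1$, and $t\in[0,1]$. Then (a) $|q|^{t+1}\cos^t(\alpha)\,w_q^t(A)\le |q|^t w_q(A^t)\le \sec^{2t}(\alpha)\sec(t\alpha)\,w_q^t(A)$, and (b) $|q|^{t+1}\cos(t\alpha)\cos^{2t}(\alpha)\,w_q^{-t}(A)\le w_q(A^{-t})$.
   Context: $M_n$ is the algebra of complex $n\times n$ matrices. For $|q|\le1$, $w_q(A)=\sup\{|\langle Ax,y\rangle|: \|x\|=\|y\|=1,\ \langle x,y\rangle=q\}$, and $w_q^t(A)$ denotes $(w_q(A))^t$. $W(A)=\{\langle Ax,x\rangle:\|x\|=1\}$, $S_\alpha=\{z:\operatorname{Re}z>0,\ |\operatorname{Im}z|\le\tan(\alpha)\operatorname{Re}z\}$ and $\Pi^n_{s,\alpha}=\{A\in M_n: W(A)\subseteq S_\alpha\}$. Such $A$ has no eigenvalues on $(-\infty,0]$ and $A^{t}$, $A^{-t}$ denote the principal fractional powers. *)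

(* Defs.v *)
From HB Require Import structures.
From mathcomp Require Import all_boot all_order all_algebra.
From mathcomp Require Import all_classical all_reals all_analysis.
From mathcomp Require Import complex.
Set Implicit Arguments. Unset Strict Implicit. Unset Printing Implicit Defensive.
Import Order.TTheory GRing.Theory Num.Theory.
Import numFieldNormedType.Exports.
Local Open Scope ring_scope.
Local Open Scope complex_scope.
Local Open Scope classical_set_scope.

(* Give R[i] its canonical (numFieldType) normed/topological structure, so that
   limits of sequences of complex matrices make sense (entrywise topology). *)
HB.instance Definition _ (R : rcfType) := NormedModule.copy R[i] (R[i])^o.

Definition cmod (R : rcfType) (z : R[i]) : R := Num.sqrt (complex.Re z ^+ 2 + complex.Im z ^+ 2).

Definition cdot (R : realType) (n : nat) (x y : 'cV[R[i]]_n) : R[i] :=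
  \sum_(i < n) x i 0 * (y i 0)^*.

Definition unitv (R : realType) (n : nat) (x : 'cV[R[i]]_n) : Prop :=
  cdot x x = 1.

Definition wq (R : realType) (n : nat) (q : R[i]) (A : 'M[R[i]]_n) : R :=
  sup [set r : R | exists x y : 'cV[R[i]]_n,
         [/\ unitv x, unitv y, cdot x y = q & r = cmod (cdot (A *m x) y)]].

Definition sector (R : realType) (alpha : R) (z : R[i]) : Prop :=
  0 < complex.Re z /\ `|complex.Im z| <= tan alpha * complex.Re z.

Definition PiSector (R : realType) (n : nat) (alpha : R) (A : 'M[R[i]]_n) : Prop :=
  forall x : 'cV[R[i]]_n, unitv x -> sector alpha (cdot (A *m x) x).

Definition mexp (R : realType) (n : nat) (X : 'M[R[i]]_n) : 'M[R[i]]_n :=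
  lim ((fun N : nat => \sum_(k < N) ((k`!)%:R)^-1 *: X ^+ k) @ \oo).

(* Principal logarithm: the unique X with exp(X) = A whose eigenvalues all
   have imaginary part in (-pi, pi) (exists and is unique when A has no
   eigenvalues on (-oo, 0]). *)
Definition plog (R : realType) (n : nat) (A : 'M[R[i]]_n) : 'M[R[i]]_n :=
  xget 0 [set X : 'M[R[i]]_n | mexp X = A /\
            (forall l : R[i], eigenvalue X l -> - pi < complex.Im l < pi)].

Definition mpow (R : realType) (n : nat) (t : R) (A : 'M[R[i]]_n) : 'M[R[i]]_n :=
  mexp ((t%:C) *: plog A).

(* Main.v *)
Require Import Defs.
From HB Require Import structures.
From mathcomp Require Import all_boot all_order all_algebra.
From mathcomp Require Import all_classical all_reals all_analysis.
From mathcomp Require Import complex ring lra.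
Set Implicit Arguments. Unset Strict Implicit. Unset Printing Implicit Defensive.
Import Order.TTheory GRing.Theory Num.Theory.
Import numFieldNormedType.Exports.
Local Open Scope ring_scope.
Local Open Scope complex_scope.
Local Open Scope classical_set_scope.

(** Let r be the largest eigenvalue of Re A. Sectoriality gives |<Ax,y>| <= r sec(alpha) for unit
    x, y and Re A^-1 >= cos^2(alpha)/r, while w_q(B) >= |q||<Bx,x>| for every B and unit x. So
    everything follows from one fact: if Re A >= H > 0 then Re A^t >= H^t for t in [0,1]. Applied
    to A it bounds w_q(A^t) from below at the top eigenvector of Re A; applied to A^-1 it gives
    Re A^-t >= (cos^2(alpha)/r)^t, hence (b) and ||A^t|| <= (sec^2(alpha) r)^t.

    The set of exponents t with Re A^t >= H^t contains 0 and 1, is closed, and is stable under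
    midpoints: A^((s+t)/2) is the limit of the arithmetic-harmonic mean iteration started at
    (A^s, A^t), and both means respect lower bounds on real parts. The iteration converges by a
    scalar computation when log A is diagonalizable; since exp is continuous, it suffices to
    perturb log A to reach the general case. A logarithm exists by induction on the size of a
    triangular form of A. *)

(** The strip |Im| < pi for the spectrum of log A does two jobs. First, exp is injective on it, so
    the linear system met when a triangular logarithm is enlarged by one row is solvable. Second,
    for exponents a, b in [0,1] the eigenvalues of A^((a-b)/2) have argument below pi/2, which is
    what makes the arithmetic-harmonic iteration from A^a and A^b converge to A^((a+b)/2) and not to
    another square root of A^(a+b). The strip is symmetric, so the power inequality, stated for
    exp(tX) with any X whose spectrum lies in it, applies to -X as it stands, and A^-1 needs no
    logarithm of its own.

    The lower bound H is carried as weights in a fixed eigenbasis of Re A, so that its means and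
    powers are scalar operations. A scalar bound would see only the lowest eigenvalue of Re A,
    whereas the lower bound on w_q(A^t) needs the value r^t at the top eigenvector. For A^-1
    constant weights suffice, because cos^2(alpha)/r already bounds its real part from below on the
    whole space. *)

Local Notation cRe := complex.Re.
Local Notation cIm := complex.Im.

(** * Complex numbers and entrywise limits *)

Section Modulus.
Variable R : realType.
Implicit Types a b z : R[i].

Lemma complex_eq a b : cRe a = cRe b -> cIm a = cIm b -> a = b.
Proof. by case: a b => [a1 a2] [b1 b2] /= -> ->. Qed.

Lemma cReD a b : cRe (a + b) = cRe a + cRe b.
Proof. by case: a b => [a1 a2] [b1 b2]. Qed.
Lemma cImD a b : cIm (a + b) = cIm a + cIm b.
Proof. by case: a b => [a1 a2] [b1 b2]. Qed.
Lemma cReN a : cRe (- a) = - cRe a.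
Proof. by case: a. Qed.
Lemma cImN a : cIm (- a) = - cIm a.
Proof. by case: a. Qed.
Lemma cReM a b : cRe (a * b) = cRe a * cRe b - cIm a * cIm b.
Proof. by case: a b => [a1 a2] [b1 b2]. Qed.
Lemma cImM a b : cIm (a * b) = cRe a * cIm b + cIm a * cRe b.
Proof. by case: a b => [a1 a2] [b1 b2]. Qed.
Lemma cReJ a : cRe (a^*) = cRe a.
Proof. by case: a. Qed.
Lemma cImJ a : cIm (a^*) = - cIm a.
Proof. by case: a. Qed.

Lemma cRe_sum (I : Type) (r : seq I) (P : pred I) (F : I -> R[i]) :
  cRe (\sum_(i <- r | P i) F i) = \sum_(i <- r | P i) cRe (F i).
Proof.
elim: r => [|i r ih]; first by rewrite !big_nil.
by rewrite !big_cons; case: (P i) => //; rewrite cReD ih.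
Qed.
Lemma cIm_sum (I : Type) (r : seq I) (P : pred I) (F : I -> R[i]) :
  cIm (\sum_(i <- r | P i) F i) = \sum_(i <- r | P i) cIm (F i).
Proof.
elim: r => [|i r ih]; first by rewrite !big_nil.
by rewrite !big_cons; case: (P i) => //; rewrite cImD ih.
Qed.

Lemma normcE_cmod z : `|z| = (cmod z)%:C.
Proof. exact: normc_def. Qed.

Lemma cmod_ge0 z : 0 <= cmod z. Proof. exact: sqrtr_ge0. Qed.

Lemma cmodM a b : cmod (a * b) = cmod a * cmod b.
Proof. by apply: complexI; rewrite rmorphM /= -!normcE_cmod normrM. Qed.

Lemma cmodD a b : cmod (a + b) <= cmod a + cmod b.
Proof. by rewrite -lecR rmorphD /= -!normcE_cmod ler_normD. Qed.

Lemma cmodN a : cmod (- a) = cmod a.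
Proof. by apply: complexI; rewrite -!normcE_cmod normrN. Qed.

Lemma cmodJ a : cmod (a^*) = cmod a.
Proof. by rewrite /cmod cReJ cImJ sqrrN. Qed.

Lemma cmod0 : cmod (0 : R[i]) = 0.
Proof. by apply: complexI; rewrite -!normcE_cmod normr0. Qed.

Lemma cmod1 : cmod (1 : R[i]) = 1.
Proof. by apply: complexI; rewrite -!normcE_cmod normr1. Qed.

Lemma cmod_eq0 a : (cmod a == 0) = (a == 0).
Proof. by rewrite -(inj_eq (@complexI R)) -normcE_cmod normr_eq0. Qed.

Lemma cmodR (x : R) : cmod (x%:C) = `|x|.
Proof. by rewrite /cmod /= expr0n addr0 sqrtr_sqr. Qed.

Lemma cmodX a n : cmod (a ^+ n) = cmod a ^+ n.
Proof. by apply: complexI; rewrite rmorphXn /= -!normcE_cmod normrX. Qed.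

Lemma cmodV a : cmod (a^-1) = (cmod a)^-1.
Proof. by apply: complexI; rewrite fmorphV /= -!normcE_cmod normfV. Qed.

Lemma cmod_sqr z : cmod z ^+ 2 = cRe z ^+ 2 + cIm z ^+ 2.
Proof. by rewrite sqr_sqrtr // addr_ge0 ?sqr_ge0. Qed.

Lemma cRe_le_cmod z : `|cRe z| <= cmod z.
Proof. by rewrite -sqrtr_sqr ler_wsqrtr // lerDl sqr_ge0. Qed.
Lemma cIm_le_cmod z : `|cIm z| <= cmod z.
Proof. by rewrite -sqrtr_sqr ler_wsqrtr // lerDr sqr_ge0. Qed.

Lemma cmod_le z : cmod z <= `|cRe z| + `|cIm z|.
Proof.
rewrite -[leRHS]ger0_norm ?addr_ge0 // -sqrtr_sqr; apply: ler_wsqrtr.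
rewrite sqrrD !real_normK ?num_real // addrAC lerDl.
by rewrite mulrn_wge0 // mulr_ge0.
Qed.

Lemma cmod_sum (I : Type) (r : seq I) (P : pred I) (F : I -> R[i]) :
  cmod (\sum_(i <- r | P i) F i) <= \sum_(i <- r | P i) cmod (F i).
Proof.
elim: r => [|i r ih]; first by rewrite !big_nil cmod0.
rewrite !big_cons; case: (P i) => //.
by rewrite (le_trans (cmodD _ _)) // lerD2l.
Qed.

Lemma natr_realC (n : nat) : (n%:R : R[i]) = (n%:R : R)%:C.
Proof. by rewrite (rmorph_nat (real_complex R)). Qed.

Lemma mulJ_Re z : z * z^* = (cmod z ^+ 2)%:C.
Proof. by apply: complex_eq; rewrite ?cReM ?cImM cReJ cImJ /= ?cmod_sqr; ring. Qed.

End Modulus.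

Section Convergence.
Variable R : realType.

(** Stated on real and imaginary parts so that limits and series of reals apply directly;
    [ccvg_topology] links it to the topology of [R[i]]. *)
Definition ccvg (u : nat -> R[i]) (l : R[i]) : Prop :=
  ((fun k => cRe (u k)) @ \oo --> cRe l) /\ ((fun k => cIm (u k)) @ \oo --> cIm l).

Lemma ccvg_cst (l : R[i]) : ccvg (fun=> l) l.
Proof. by split; exact: cvg_cst. Qed.

Lemma ccvgD u v a b : ccvg u a -> ccvg v b -> ccvg (fun k => u k + v k) (a + b).
Proof.
move=> [u1 u2] [v1 v2]; split.
  by rewrite cReD; under eq_fun do rewrite cReD; exact: cvgD.
by rewrite cImD; under eq_fun do rewrite cImD; exact: cvgD.
Qed.

Lemma ccvgM u v a b : ccvg u a -> ccvg v b -> ccvg (fun k => u k * v k) (a * b).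
Proof.
move=> [u1 u2] [v1 v2]; split.
  rewrite cReM; under eq_fun do rewrite cReM; apply: cvgB; exact: cvgM.
by rewrite cImM; under eq_fun do rewrite cImM; apply: cvgD; exact: cvgM.
Qed.

Lemma ccvg_sum (I : Type) (r : seq I) (P : pred I) (F : I -> nat -> R[i]) (l : I -> R[i]) :
  (forall i, ccvg (F i) (l i)) ->
  ccvg (fun k => \sum_(i <- r | P i) F i k) (\sum_(i <- r | P i) l i).
Proof.
move=> h; elim: r => [|i r ih].
  by rewrite big_nil; under eq_fun do rewrite big_nil; exact: ccvg_cst.
rewrite big_cons; under eq_fun do rewrite big_cons.
by case: (P i) => //; apply: ccvgD.
Qed.

Lemma ccvgN u a : ccvg u a -> ccvg (fun k => - u k) (- a).
Proof.
move=> h; rewrite -mulN1r; under eq_fun do rewrite -mulN1r.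
by apply: ccvgM => //; exact: ccvg_cst.
Qed.

Lemma ccvg_cmod u a : ccvg u a <-> (fun k => cmod (u k - a)) @ \oo --> (0 : R).
Proof.
split.
  move=> [h1 h2].
  have h : (fun k => `|cRe (u k) - cRe a| + `|cIm (u k) - cIm a|) @ \oo --> (0 : R).
    rewrite -[X in _ --> X]addr0; apply: cvgD.
      by rewrite -(normr0 R); apply: cvg_norm; apply/subr_cvg0.
    by rewrite -(normr0 R); apply: cvg_norm; apply/subr_cvg0.
  apply: (squeeze_cvgr _ (cvg_cst 0) h); near=> k.
  by rewrite cmod_ge0 /= (le_trans (cmod_le _)) // cReD cReN cImD cImN.
move=> h; split; apply/subr_cvg0; apply/norm_cvg0P;
    apply: (squeeze_cvgr _ (cvg_cst 0) h); near=> k.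
  by rewrite /= normr_ge0 /= -cReN -cReD cRe_le_cmod.
by rewrite /= normr_ge0 /= -cImN -cImD cIm_le_cmod.
Unshelve. all: by end_near. Qed.

Lemma ccvg_unique u a b : ccvg u a -> ccvg u b -> a = b.
Proof.
move=> [u1 u2] [v1 v2]; apply: complex_eq.
  by apply: (cvg_unique _ u1 v1); exact: Rhausdorff.
by apply: (cvg_unique _ u2 v2); exact: Rhausdorff.
Qed.

Lemma ccvg_cmod_le u a c : ccvg u a -> (forall k, cmod (u k) <= c) -> cmod a <= c.
Proof.
move=> /ccvg_cmod h hc.
have hlim : (fun k => cmod (u k - a) + c) @ \oo --> 0 + c.
  by apply: cvgD => //; exact: cvg_cst.
rewrite -[leRHS]add0r.
apply: (ler_cvg_to (cvg_cst (cmod a)) hlim); near=> k.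
have {1}-> : a = u k + - (u k - a) by rewrite opprB addrC subrK.
by rewrite (le_trans (cmodD _ _)) // cmodN addrC lerD2l.
Unshelve. all: by end_near. Qed.

Lemma ccvg_topology u (a : R[i]) : ccvg u a -> u @ \oo --> a.
Proof.
move=> /ccvg_cmod/cvgrPdist_lt h; apply/cvgrPdist_lt => -[e e'].
rewrite ltcE /= => /andP[/eqP -> e0].
have := h e e0; apply: filterS => k.
by rewrite sub0r normrN ger0_norm ?cmod_ge0 // distrC normcE_cmod ltcR.
Qed.

Definition mcvg m n (u : nat -> 'M[R[i]]_(m, n)) (L : 'M[R[i]]_(m, n)) : Prop :=
  forall i j, ccvg (fun k => u k i j) (L i j).

(** The link with the [lim] in the definition of [mexp]: neighbourhoods of a matrix are given entry
    by entry, and each entry has a unique limit because [R[i]] is Hausdorff. *)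
Lemma mcvg_lim m n (u : nat -> 'M[R[i]]_(m, n)) L : mcvg u L -> lim (u @ \oo) = L.
Proof.
move=> h.
have huL : u @ \oo --> L.
  move=> A [P hP hA]; apply: filterS (_ : \forall k \near \oo, forall i j, P i j (u k i j)).
    by move=> k; exact: hA.
  apply: filter_forall => i; apply: filter_forall => j.
  exact: (ccvg_topology (h i j) (hP i j)).
have hl : u @ \oo --> lim (u @ \oo) by apply/cvg_ex; exists L.
apply/matrixP => i j.
apply: (@cvg_unique R[i] (@norm_hausdorff _ _) ((fun k => u k i j) @ \oo)) => //.
  move=> A hA; apply: (hl (fun M : 'M[R[i]]_(m, n) => A (M i j))).
  exists (fun i' j' => if (i' == i) && (j' == j) then A else setT).
    move=> i' j'; case: ifP => [/andP[/eqP -> /eqP ->]//|_]; exact: filterT.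
  by move=> M /(_ i j); rewrite !eqxx.
exact: ccvg_topology.
Qed.

Lemma mcvg_unique m n (u : nat -> 'M[R[i]]_(m, n)) K L : mcvg u K -> mcvg u L -> K = L.
Proof. by move=> /mcvg_lim <- /mcvg_lim <-. Qed.

End Convergence.

(** * The exponential series of a matrix *)

Section Norm1.
Variable R : realType.

Definition nrm1 m n (A : 'M[R[i]]_(m, n)) : R := \sum_i \sum_j cmod (A i j).

Lemma nrm1_ge0 m n (A : 'M[R[i]]_(m, n)) : 0 <= nrm1 A.
Proof. by apply: sumr_ge0 => i _; apply: sumr_ge0 => j _; exact: cmod_ge0. Qed.

Lemma row_le_nrm1 m n (A : 'M[R[i]]_(m, n)) i : \sum_j cmod (A i j) <= nrm1 A.
Proof.
rewrite /nrm1 (bigD1 i) //= lerDl; apply: sumr_ge0 => k _.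
by apply: sumr_ge0 => j _; exact: cmod_ge0.
Qed.

Lemma entry_le_nrm1 m n (A : 'M[R[i]]_(m, n)) i j : cmod (A i j) <= nrm1 A.
Proof.
rewrite (le_trans _ (row_le_nrm1 A i)) // (bigD1 j) //= lerDl.
by apply: sumr_ge0 => k _; exact: cmod_ge0.
Qed.

Lemma nrm1D m n (A B : 'M[R[i]]_(m, n)) : nrm1 (A + B) <= nrm1 A + nrm1 B.
Proof.
rewrite /nrm1 -big_split; apply: ler_sum => i _; rewrite -big_split /=.
by apply: ler_sum => j _; rewrite mxE cmodD.
Qed.

Lemma nrm10 m n : nrm1 (0 : 'M[R[i]]_(m, n)) = 0.
Proof. by rewrite /nrm1 big1 // => i _; rewrite big1 // => j _; rewrite mxE cmod0. Qed.

Lemma nrm1Z m n a (A : 'M[R[i]]_(m, n)) : nrm1 (a *: A) = cmod a * nrm1 A.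
Proof.
rewrite /nrm1 mulr_sumr; apply: eq_bigr => i _; rewrite mulr_sumr.
by apply: eq_bigr => j _; rewrite mxE cmodM.
Qed.

Lemma nrm1_sum m n (I : Type) (r : seq I) (P : pred I) (F : I -> 'M[R[i]]_(m, n)) :
  nrm1 (\sum_(i <- r | P i) F i) <= \sum_(i <- r | P i) nrm1 (F i).
Proof.
elim: r => [|i r ih]; first by rewrite !big_nil nrm10.
rewrite !big_cons; case: (P i) => //.
by rewrite (le_trans (nrm1D _ _)) // lerD2l.
Qed.

Lemma nrm1M m n p (A : 'M[R[i]]_(m, n)) (B : 'M[R[i]]_(n, p)) :
  nrm1 (A *m B) <= nrm1 A * nrm1 B.
Proof.
rewrite {1 2}/nrm1 mulr_suml; apply: ler_sum => i _.
apply: (@le_trans _ _ (\sum_j \sum_k cmod (A i k) * cmod (B k j))).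
  apply: ler_sum => j _; rewrite mxE (le_trans (cmod_sum _ _ _)) //.
  by apply: ler_sum => k _; rewrite cmodM.
rewrite exchange_big mulr_suml; apply: ler_sum => k _.
by rewrite -mulr_sumr ler_wpM2l ?cmod_ge0 ?row_le_nrm1.
Qed.

(** The norm is submultiplicative but equals n at the identity; the constant pays for the case k =
    0. *)
Lemma nrm1X n (A : 'M[R[i]]_n) k : nrm1 (A ^+ k) <= nrm1 (1%:M : 'M[R[i]]_n) * nrm1 A ^+ k.
Proof.
elim: k => [|k ih]; first by rewrite !expr0 mulr1.
rewrite exprSr [in leRHS]exprSr mulrA (le_trans (nrm1M _ _)) //.
by rewrite ler_wpM2r ?nrm1_ge0.
Qed.

End Norm1.

Section RealExp.
Variable R : realType.

Definition rexpsum (x : R) (N : nat) : R := \sum_(k < N) x ^+ k / k`!%:R.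

Lemma rexpsumE x : rexpsum x = series (exp_coeff x).
Proof. by apply/funext => N; rewrite /rexpsum /series /= big_mkord. Qed.

Lemma cvg_rexpsum x : rexpsum x @ \oo --> expR x.
Proof. by rewrite rexpsumE; exact: is_cvg_series_exp_coeff. Qed.

Lemma rexpsum_le x N : 0 <= x -> rexpsum x N <= expR x.
Proof.
move=> x0; rewrite rexpsumE; apply: nondecreasing_cvgn_le.
  by apply: nondecreasing_series => k _ _; rewrite /exp_coeff /= divr_ge0 // exprn_ge0.
exact: is_cvg_series_exp_coeff.
Qed.

End RealExp.

Section MatrixExp.
Variables (R : realType).

Definition expsum n (X : 'M[R[i]]_n) (N : nat) : 'M[R[i]]_n :=
  \sum_(k < N) ((k`!)%:R)^-1 *: X ^+ k.

Lemma cmod_invfact k : cmod ((k`!%:R : R[i])^-1) = (k`!%:R)^-1.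
Proof. by rewrite cmodV natr_realC cmodR ger0_norm. Qed.

Lemma cvg_dominated_series (u : nat -> R) (v : nat -> R) :
  (forall k, `|u k| <= v k) -> cvgn (series v) -> cvgn (series u).
Proof.
move=> h hv; apply: normed_cvg.
apply: (@series_le_cvg _ _ v) hv => k //=; exact: le_trans (normr_ge0 _) (h k).
Qed.

(** Each entry of the series is dominated by a multiple of the real exponential series at [nrm1 X],
    so its real and imaginary parts converge absolutely. *)
Lemma mexp_cvg n (X : 'M[R[i]]_n) : mcvg (expsum X) (mexp X).
Proof.
pose c := nrm1 (1%:M : 'M[R[i]]_n).
have entryE i j N : expsum X N i j = \sum_(0 <= k < N) (k`!%:R)^-1 * (X ^+ k) i j.
  by rewrite /expsum summxE big_mkord; apply: eq_bigr => k _; rewrite mxE.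
have bnd i j k : cmod ((k`!%:R)^-1 * (X ^+ k) i j) <= c * exp_coeff (nrm1 X) k.
  rewrite cmodM cmod_invfact mulrC /exp_coeff /= mulrA ler_wpM2r ?invr_ge0 //.
  by rewrite (le_trans (entry_le_nrm1 _ _ _)) ?nrm1X.
have cv : cvgn (series (fun k => c * exp_coeff (nrm1 X) k)).
  by apply: is_cvg_seriesZ; exact: is_cvg_series_exp_coeff.
pose L : 'M[R[i]]_n := \matrix_(i, j)
  (Complex (limn (series (fun k => cRe ((k`!%:R)^-1 * (X ^+ k) i j))))
           (limn (series (fun k => cIm ((k`!%:R)^-1 * (X ^+ k) i j))))).
have hL : mcvg (expsum X) L.
  move=> i j; rewrite /L mxE; split => /=.
    under eq_fun do rewrite entryE cRe_sum.
    apply: (cvg_dominated_series _ cv) => k.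
    exact: le_trans (cRe_le_cmod _) (bnd i j k).
  under eq_fun do rewrite entryE cIm_sum.
  apply: (cvg_dominated_series _ cv) => k.
  exact: le_trans (cIm_le_cmod _) (bnd i j k).
by rewrite /mexp -/(expsum X) (mcvg_lim hL).
Qed.

(** Telescoping: X^(k+1) - Y^(k+1) = X^k (X - Y) + (X^k - Y^k) Y. With [1 <= c] the first term is
    bounded by c^(k+1) instead of c^k, which keeps predecessors out of the exponent. *)
Lemma expr_lipschitz n (X Y : 'M[R[i]]_n) c k : 1 <= c -> nrm1 X <= c -> nrm1 Y <= c ->
  nrm1 (X ^+ k - Y ^+ k) <= nrm1 (1%:M : 'M[R[i]]_n) * nrm1 (X - Y) * (k%:R * c ^+ k).
Proof.
move=> c1 hX hY; have c0 : 0 <= c by rewrite (le_trans _ c1).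
elim: k => [|k ih]; first by rewrite !expr0 subrr nrm10 mul0r mulr0.
have -> : X ^+ k.+1 - Y ^+ k.+1 = X ^+ k * (X - Y) + (X ^+ k - Y ^+ k) * Y.
  by rewrite mulrBr mulrBl -!exprSr addrA subrK.
rewrite (le_trans (nrm1D _ _)) //.
set d := nrm1 (X - Y); set e := nrm1 1%:M.
have d0 : 0 <= d by exact: nrm1_ge0.
have e0 : 0 <= e by exact: nrm1_ge0.
have ck : 0 <= c ^+ k by rewrite exprn_ge0.
have h1 : nrm1 (X ^+ k * (X - Y)) <= e * d * c ^+ k.
  rewrite (le_trans (nrm1M _ _)) // mulrAC ler_wpM2r //.
  rewrite (le_trans (nrm1X _ _)) // ler_wpM2l //.
  by rewrite lerXn2r ?nnegrE ?nrm1_ge0.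
have h2 : nrm1 ((X ^+ k - Y ^+ k) * Y) <= e * d * (k%:R * c ^+ k) * c.
  by rewrite (le_trans (nrm1M _ _)) // ler_pM ?nrm1_ge0.
rewrite (le_trans (lerD h1 h2)) // exprSr.
have -> : e * d * c ^+ k + e * d * (k%:R * c ^+ k) * c
   = e * d * (c ^+ k + k%:R * (c ^+ k * c)) by ring.
rewrite ler_wpM2l ?mulr_ge0 // -natr1 mulrDl mul1r addrC lerD2l.
by rewrite ler_peMr.
Qed.

Lemma mexp_lipschitz n (X Y : 'M[R[i]]_n) c i j : 1 <= c -> nrm1 X <= c -> nrm1 Y <= c ->
  cmod ((mexp X - mexp Y) i j)
    <= nrm1 (1%:M : 'M[R[i]]_n) * nrm1 (X - Y) * expR (2 * c).
Proof.
move=> c1 hX hY; have c0 : 0 <= c by rewrite (le_trans _ c1).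
apply: (@ccvg_cmod_le _ (fun N => (expsum X N - expsum Y N) i j)).
  rewrite !mxE; under eq_fun do rewrite !mxE.
  by apply: ccvgD; [|apply: ccvgN]; exact: mexp_cvg.
move=> N; apply: le_trans (entry_le_nrm1 _ _ _) _.
rewrite /expsum -sumrB (le_trans (nrm1_sum _ _ _)) //.
(* Since k < 2^k, the factor k c^k is at most (2c)^k, and the sum is a partial sum of the series of
   exp(2c). *)
apply: (@le_trans _ _ (\sum_(k < N) nrm1 (1%:M : 'M[R[i]]_n) * nrm1 (X - Y) * ((2 * c) ^+ k / k`!%:R))).
  apply: ler_sum => k _; rewrite -scalerBr nrm1Z cmod_invfact mulrC mulrA.
  rewrite ler_wpM2r ?invr_ge0 // (le_trans (expr_lipschitz _ c1 hX hY)) //.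
  rewrite ler_wpM2l ?mulr_ge0 ?nrm1_ge0 // exprMn ler_wpM2r ?exprn_ge0 //.
  by rewrite -natrX ler_nat ltnW // ltn_expl.
rewrite -mulr_sumr ler_wpM2l ?mulr_ge0 ?nrm1_ge0 //.
by apply: rexpsum_le; rewrite mulr_ge0.
Qed.

(** The square of indices below N is the triangle i + j < N, summed along the antidiagonals i + j =
    k, plus the rest. For a Cauchy product the triangle is the partial sum of the product series and
    the rest is the error. *)
Lemma sum_square_triangle (V : zmodType) (f : nat -> nat -> V) N :
  \sum_(0 <= i < N) \sum_(0 <= j < N) f i j =
  \sum_(0 <= k < N) \sum_(0 <= j < k.+1) f (k - j)%N j
  + \sum_(0 <= j < N) \sum_(N - j <= i < N) f i j.
Proof.
rewrite exchange_big_nat /=.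
have -> : \sum_(0 <= k < N) \sum_(0 <= j < k.+1) f (k - j)%N j
   = \sum_(0 <= j < N) \sum_(0 <= i < N - j) f i j.
  transitivity (\sum_(0 <= k < N) \sum_(0 <= j < N | (j <= k)%N) f (k - j)%N j).
    apply: eq_big_nat => k /andP[_ kN].
    by rewrite (big_nat_widen _ _ N) //; apply: eq_bigl.
  rewrite (exchange_big_dep_nat predT) //=; apply: eq_big_nat => j /andP[_ jN].
  rewrite (big_cat_nat (n := j)) /=; [|by []|exact: ltnW].
  rewrite [X in X + _]big1_seq ?add0r; last first.
    by move=> k /andP[jk]; rewrite mem_index_iota => /andP[_]; rewrite ltnNge jk.
  rewrite -{1}[j]add0n big_addn.
  by apply: eq_big => [k|k _]; rewrite ?leq_addl ?addnK.
rewrite -big_split /=; apply: eq_big_nat => j /andP[_ jN].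
by rewrite -big_cat_nat //= leq_subr.
Qed.

End MatrixExp.

Section ExpMorphism.
Variables (R : realType).

Lemma invfact_bin (F : numFieldType) (k j : nat) : (j <= k)%N ->
  (k`!%:R)^-1 * 'C(k, j)%:R = ((k - j)`!%:R)^-1 * (j`!%:R)^-1 :> F.
Proof.
move=> jk; have h m : m`!%:R != 0 :> F by rewrite pnatr_eq0 -lt0n fact_gt0.
rewrite -(bin_fact jk) !natrM; field.
by rewrite !h /= pnatr_eq0 -lt0n bin_gt0.
Qed.

Lemma rexpsum_mul (x y : R) N :
  rexpsum x N * rexpsum y N = rexpsum (x + y) N
  + \sum_(0 <= j < N) \sum_(N - j <= i < N) (x ^+ i / i`!%:R) * (y ^+ j / j`!%:R).
Proof.
have -> : rexpsum x N * rexpsum y N =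
    \sum_(0 <= i < N) \sum_(0 <= j < N) (x ^+ i / i`!%:R) * (y ^+ j / j`!%:R).
  rewrite /rexpsum big_mkord mulr_suml; apply: eq_bigr => i _.
  by rewrite mulr_sumr big_mkord.
rewrite sum_square_triangle; congr (_ + _).
rewrite /rexpsum big_mkord; apply: eq_bigr => k _.
rewrite exprDn mulr_suml big_mkord; apply: eq_bigr => j _.
transitivity (((k`!%:R)^-1 * 'C(k, j)%:R) * (x ^+ (k - j) * y ^+ j)).
  by rewrite invfact_bin -1?ltnS //; ring.
by rewrite -[_ *+ 'C(_, _) in RHS]mulr_natl; ring.
Qed.

Lemma expsum_mul n (X Y : 'M[R[i]]_n) N : comm_mx X Y ->
  expsum X N *m expsum Y N = expsum (X + Y) N
  + \sum_(0 <= j < N) \sum_(N - j <= i < N)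
      ((i`!%:R)^-1 * (j`!%:R)^-1) *: (X ^+ i *m Y ^+ j).
Proof.
move=> cXY.
have -> : expsum X N *m expsum Y N = \sum_(0 <= i < N) \sum_(0 <= j < N)
      ((i`!%:R)^-1 * (j`!%:R)^-1) *: (X ^+ i *m Y ^+ j).
  rewrite /expsum big_mkord mulmx_suml; apply: eq_bigr => i _.
  rewrite mulmx_sumr big_mkord; apply: eq_bigr => j _.
  by rewrite -scalemxAl -scalemxAr scalerA.
rewrite sum_square_triangle; congr (_ + _).
rewrite /expsum big_mkord; apply: eq_bigr => k _.
rewrite exprDn_comm // scaler_sumr big_mkord; apply: eq_bigr => j _.
by rewrite -[_ *+ 'C(_, _) in RHS]scaler_nat scalerA invfact_bin // -ltnS.
Qed.

(** The error of the matrix Cauchy product is bounded, term by term, by the error of the scalar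
    Cauchy product at [nrm1 X] and [nrm1 Y]. The scalar error tends to 0 because the real
    exponential is already known to be multiplicative. *)
Lemma mexpD n (X Y : 'M[R[i]]_n) : comm_mx X Y -> mexp (X + Y) = mexp X *m mexp Y.
Proof.
move=> cXY; pose c := nrm1 (1%:M : 'M[R[i]]_n).
have c0 : 0 <= c by exact: nrm1_ge0.
pose D N := expsum X N *m expsum Y N - expsum (X + Y) N.
pose x := nrm1 X; pose y := nrm1 Y.
have x0 : 0 <= x by exact: nrm1_ge0.
have y0 : 0 <= y by exact: nrm1_ge0.
have hD N : nrm1 (D N) <= c ^+ 2 * (rexpsum x N * rexpsum y N - rexpsum (x + y) N).
  rewrite /D expsum_mul // addrAC subrr add0r rexpsum_mul addrAC subrr add0r.
  rewrite (le_trans (nrm1_sum _ _ _)) // mulr_sumr; apply: ler_sum => j _.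
  rewrite (le_trans (nrm1_sum _ _ _)) // mulr_sumr; apply: ler_sum => i _.
  rewrite nrm1Z cmodM !cmod_invfact.
  have -> : c ^+ 2 * (x ^+ i / i`!%:R * (y ^+ j / j`!%:R)) =
            (i`!%:R)^-1 * (j`!%:R)^-1 * ((c * x ^+ i) * (c * y ^+ j)) by ring.
  rewrite ler_wpM2l ?mulr_ge0 ?invr_ge0 // (le_trans (nrm1M _ _)) //.
  by rewrite ler_pM ?nrm1_ge0 ?nrm1X.
have hlim : (fun N => c ^+ 2 * (rexpsum x N * rexpsum y N - rexpsum (x + y) N)) @ \oo --> (0 : R).
  rewrite -[X in _ --> X](mulr0 (c ^+ 2)); apply: cvgMr.
  rewrite -[X in _ --> X](subrr (expR (x + y))) {1}expRD.
  by apply: cvgB; [apply: cvgM|]; exact: cvg_rexpsum.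
apply/matrixP => i j; apply: (@ccvg_unique _ (fun N => expsum (X + Y) N i j)).
  exact: mexp_cvg.
have h1 : ccvg (fun N => (expsum X N *m expsum Y N) i j) ((mexp X *m mexp Y) i j).
  rewrite mxE; under eq_fun do rewrite mxE.
  by apply: ccvg_sum => k; apply: ccvgM; exact: mexp_cvg.
have h2 : ccvg (fun N => D N i j) 0.
  apply/ccvg_cmod; apply: (squeeze_cvgr _ (cvg_cst 0) hlim); near=> N.
  by rewrite subr0 cmod_ge0 /= (le_trans (entry_le_nrm1 _ _ _)).
have := ccvgD h1 (ccvgN h2); rewrite subr0; congr ccvg; apply/funext => N.
by rewrite /D [X in _ - X]mxE [X in _ - (_ + X)]mxE subKr.
Unshelve. all: by end_near. Qed.

Lemma mexp0 n : mexp (0 : 'M[R[i]]_n) = 1%:M.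
Proof.
apply: (mcvg_unique (mexp_cvg _)) => i j.
rewrite /ccvg; split; apply: cvg_near_cst; exists 1%N => // -[//|N] _;
  rewrite /expsum big_ord_recl big1 ?addr0 ?expr0 ?fact0 ?invr1 ?scale1r // => k _;
  by rewrite expr0n /= scaler0.
Qed.

Lemma mexpNK n (X : 'M[R[i]]_n) : mexp X *m mexp (- X) = 1%:M.
Proof.
rewrite -mexpD ?subrr ?mexp0 //.
by rewrite /comm_mx mulmxN mulNmx.
Qed.

Lemma mexp_conj n (V W X : 'M[R[i]]_n) : W *m V = 1%:M ->
  mexp (V *m X *m W) = V *m mexp X *m W.
Proof.
move=> WV.
have VW : V *m W = 1%:M by exact: mulmx1C.
have hX k : (V *m X *m W) ^+ k = V *m X ^+ k *m W.
  elim: k => [|k ih]; first by rewrite !expr0 mulmx1 VW.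
  rewrite !exprS ih -mulmxE !mulmxA; congr (_ *m _).
  by rewrite -[_ *m W *m V]mulmxA WV mulmx1.
apply: (mcvg_unique (mexp_cvg _)) => i j.
have hs N : expsum (V *m X *m W) N = V *m expsum X N *m W.
  rewrite /expsum mulmx_sumr mulmx_suml; apply: eq_bigr => k _.
  by rewrite hX -scalemxAr -scalemxAl.
under eq_fun do rewrite hs mxE; rewrite mxE.
apply: ccvg_sum => k; apply: ccvgM; last exact: ccvg_cst.
under eq_fun do rewrite mxE; rewrite mxE.
apply: ccvg_sum => l; apply: ccvgM; first exact: ccvg_cst.
exact: mexp_cvg.
Qed.

(** The complex exponential in closed form; [cexpsum_cvg] identifies it with the sum of the power
    series. *)
Definition cexp (z : R[i]) : R[i] :=
  Complex (expR (cRe z) * cos (cIm z)) (expR (cRe z) * sin (cIm z)).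

Definition cexpsum (z : R[i]) (N : nat) : R[i] := \sum_(k < N) (k`!%:R)^-1 * z ^+ k.

Lemma cexpD z w : cexp (z + w) = cexp z * cexp w.
Proof.
by apply: complex_eq; rewrite ?cReM ?cImM /= cReD cImD expRD ?cosD ?sinD; ring.
Qed.

Lemma diag_mxX n (d : 'rV[R[i]]_n) k : (diag_mx d) ^+ k = diag_mx (\row_j d 0 j ^+ k).
Proof.
elim: k => [|k ih].
  rewrite expr0; apply/matrixP => i j; rewrite !mxE.
  by case: eqP => // _; rewrite expr0.
rewrite exprS ih -mulmxE mulmx_diag; congr diag_mx.
by apply/rowP => j; rewrite !mxE exprS.
Qed.

Lemma mexp_diag_of n (d e : 'rV[R[i]]_n) :
  (forall j, ccvg (cexpsum (d 0 j)) (e 0 j)) -> mexp (diag_mx d) = diag_mx e.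
Proof.
move=> h; apply: (mcvg_unique (mexp_cvg _)) => i j.
have -> : (fun N => expsum (diag_mx d) N i j) = (fun N => cexpsum (d 0 j) N *+ (i == j)).
  apply/funext => N; rewrite /expsum summxE /cexpsum.
  case: eqP => [->|/eqP ij]; last first.
    by apply: big1 => k _; rewrite diag_mxX !mxE (negPf ij) mulr0n mulr0.
  by rewrite mulr1n; apply: eq_bigr => k _; rewrite diag_mxX !mxE eqxx mulr1n.
rewrite mxE; case: eqP => [->|_]; last exact: ccvg_cst.
exact: h.
Qed.

Lemma cexpsum_real (a : R) : ccvg (cexpsum a%:C) (expR a)%:C.
Proof.
have -> : cexpsum a%:C = fun N => (rexpsum a N)%:C.
  apply/funext => N; rewrite /cexpsum /rexpsum rmorph_sum /=; apply: eq_bigr => k _.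
  by rewrite mulrC rmorphM /= rmorphXn fmorphV natr_realC.
by split; [exact: cvg_rexpsum | exact: cvg_cst].
Qed.

Lemma invfact_realC k : ((k`!%:R : R[i])^-1) = ((k`!%:R)^-1)%:C.
Proof. by rewrite natr_realC fmorphV. Qed.

(** The coefficients have the shape of [cos_coeff] and [sin_coeff], so that the series of exp(ib)
    can be recognised as theirs. *)
Lemma imag_expr (b : R) k :
  (Complex 0 b) ^+ k = Complex ((~~ odd k)%:R * (-1) ^+ k./2 * b ^+ k)
                               ((odd k)%:R * (-1) ^+ (k.-1)./2 * b ^+ k).
Proof.
have E m : (Complex 0 b) ^+ m.*2 = ((-1) ^+ m * b ^+ m.*2)%:C.
  rewrite -mul2n exprM (_ : Complex 0 b ^+ 2 = (- b ^+ 2)%:C).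
    by rewrite -(rmorphXn (real_complex R)) [in LHS]exprNn exprM.
  by apply: complex_eq; rewrite expr2 ?cReM ?cImM /=; ring.
have [ok|ok] := boolP (odd k).
  have {ok}-> : k = (k./2).*2.+1 by rewrite -[LHS]odd_double_half ok.
  move: (k./2) => m; rewrite exprSr E /= doubleK.
  by apply: complex_eq; rewrite ?cReM ?cImM /= ?exprSr; ring.
have {ok}-> : k = (k./2).*2 by rewrite -[LHS]odd_double_half (negPf ok).
by move: (k./2) => m; rewrite E doubleK /= !mul1r !mul0r.
Qed.

Lemma cexpsum_imag (b : R) : ccvg (cexpsum (Complex 0 b)) (Complex (cos b) (sin b)).
Proof.
split => /=.
  have -> : (fun k => cRe (cexpsum (Complex 0 b) k)) = series (cos_coeff b).
    apply/funext => N; rewrite /cexpsum cRe_sum /series /= big_mkord.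
    apply: eq_bigr => k _; rewrite imag_expr invfact_realC. rewrite cReM /=.
    by rewrite /cos_coeff /= -?exprnP; ring.
  rewrite cos.unlock; exact: is_cvg_series_cos_coeff.
have -> : (fun k => cIm (cexpsum (Complex 0 b) k)) = series (sin_coeff b).
  apply/funext => N; rewrite /cexpsum cIm_sum /series /= big_mkord.
  apply: eq_bigr => k _; rewrite imag_expr invfact_realC. rewrite cImM /=.
  by rewrite /sin_coeff /= -?exprnP; ring.
rewrite sin.unlock; exact: is_cvg_series_sin_coeff.
Qed.

(** Real and imaginary parts of [d] give commuting diagonal matrices, so [mexpD] reduces the claim
    to the real exponential, cosine and sine series. *)
Lemma mexp_diag n (d : 'rV[R[i]]_n) : mexp (diag_mx d) = diag_mx (map_mx cexp d).
Proof.
pose a : 'rV[R[i]]_n := \row_j (cRe (d 0 j))%:C.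
pose b : 'rV[R[i]]_n := \row_j (Complex 0 (cIm (d 0 j))).
have -> : d = a + b.
  by apply/rowP => j; rewrite !mxE; apply: complex_eq; rewrite ?cReD ?cImD /= ?addr0 ?add0r.
rewrite raddfD mexpD; last exact: diag_mxC.
rewrite (@mexp_diag_of _ a (\row_j (expR (cRe (d 0 j)))%:C)); last first.
  by move=> j; rewrite !mxE; exact: cexpsum_real.
rewrite (@mexp_diag_of _ b (\row_j Complex (cos (cIm (d 0 j))) (sin (cIm (d 0 j))))); last first.
  by move=> j; rewrite !mxE; exact: cexpsum_imag.
rewrite mulmx_diag; congr diag_mx; apply/rowP => j; rewrite !mxE.
by apply: complex_eq; rewrite ?cReM ?cImM /cexp cReD cImD /= ?add0r ?addr0; ring.
Qed.

(** Read off from the 1 x 1 matrix case, where the product law is available. *)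
Lemma cexpsum_cvg z : ccvg (cexpsum z) (cexp z).
Proof.
have h := mexp_cvg (z%:M : 'M[R[i]]_1); move: (h 0 0).
rewrite -diag_const_mx mexp_diag !mxE eqxx mulr1n; congr ccvg.
apply/funext => N; rewrite /expsum summxE; apply: eq_bigr => k _.
by rewrite diag_mxX !mxE eqxx mulr1n.
Qed.

End ExpMorphism.

(** * Existence of a logarithm *)

Section ComplexLog.
Variable R : realType.

Lemma cexp_neq0 (z : R[i]) : cexp z != 0.
Proof.
apply/eqP => h; have := cexpD z (- z); rewrite h mul0r subrr.
move/(congr1 (@complex.Re R)); rewrite /= expR0 cos0 mulr1 => /eqP.
by rewrite oner_eq0.
Qed.

Lemma cmod_cexp (z : R[i]) : cmod (cexp z) = expR (cRe z).
Proof.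
rewrite /cmod /= !exprMn -mulrDr cos2Dsin2 mulr1 sqrtr_sqr.
by rewrite ger0_norm ?expR_ge0.
Qed.

(** By the double angle formula sin(x/2) = 0, and x/2 lies in (-pi, pi), where the sine vanishes
    only at 0. *)
Lemma cos_eq1_lt2pi (x : R) : - (pi *+ 2) < x < pi *+ 2 -> cos x = 1 -> x = 0.
Proof.
move=> /andP[x1 x2] cx; set y := x / 2.
have xy : x = y *+ 2 by rewrite /y -mulr_natr divfK.
have sy : sin y = 0.
  apply/eqP; rewrite -sqrf_eq0 sin2cos2; apply/eqP.
  by move: cx; rewrite xy cos_mulr2n => h; lra.
have [y0|y0|y0] := ltgtP y 0; last by rewrite xy y0 mul0rn.
  have : 0 < sin (- y) by apply: sin_gt0_pi; rewrite oppr_gt0 y0 /= /y; lra.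
  by rewrite sinN sy oppr0 ltxx.
have : 0 < sin y by apply: sin_gt0_pi; rewrite y0 /= /y; lra.
by rewrite sy ltxx.
Qed.

(** The moduli determine the real parts. The difference of the imaginary parts then has cosine cos^2
    + sin^2 = 1 and lies in (-2 pi, 2 pi). *)
Lemma cexp_inj_strip (z w : R[i]) : `|cIm z| < pi -> `|cIm w| < pi ->
  cexp z = cexp w -> z = w.
Proof.
rewrite !ltr_norml => /andP[z1 z2] /andP[w1 w2] h.
have hRe : cRe z = cRe w by apply: expR_inj; rewrite -!cmod_cexp h.
apply: complex_eq => //; case: h; rewrite hRe.
have e0 : expR (cRe w) != 0 by rewrite gt_eqF ?expR_gt0.
move=> /(mulfI e0) hc /(mulfI e0) hs.
apply/eqP; rewrite -subr_eq0; apply/eqP; apply: cos_eq1_lt2pi; first lra.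
by rewrite cosB hc hs -!expr2 cos2Dsin2.
Qed.

Lemma cexp_surj_right (l : R[i]) : 0 < cRe l ->
  exists2 z, cexp z = l & `|cIm z| < pi / 2.
Proof.
move=> l0; pose th := atan (cIm l / cRe l).
have th1 : `|th| < pi / 2 by rewrite ltr_norml atan_gtNpi2 atan_ltpi2.
have c0 : 0 < cos th by apply: cos_gt0_pihalf; rewrite -ltr_norml.
have m0 : 0 < cmod l by rewrite (lt_le_trans l0) // (le_trans (ler_norm _)) ?cRe_le_cmod.
have hs : sin th * cRe l = cos th * cIm l.
  have := atanK (cIm l / cRe l); rewrite -/th /tan => /eqP.
  by rewrite eqr_div ?(gt_eqF c0) ?(gt_eqF l0) // => /eqP ->; rewrite mulrC.
have hc : cmod l * cos th = cRe l.
  apply/eqP; rewrite -(@eqrXn2 _ 2) ?mulr_ge0 ?ltW // exprMn cmod_sqr; apply/eqP.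
  rewrite mulrDl -[cIm l ^+ 2 * _]exprMn [cIm l * _]mulrC -hs exprMn mulrC -mulrDl.
  by rewrite cos2Dsin2 mul1r.
exists (Complex (ln (cmod l)) th) => //.
apply: complex_eq; rewrite /= lnK //.
apply: (@mulIf _ (cRe l)); first by rewrite gt_eqF.
by rewrite -mulrA hs mulrA hc mulrC.
Qed.

End ComplexLog.

(** * Lower triangular matrices, their powers, and divided differences *)

Section LowerTriangular.
Variable F : fieldType.

(** Lower triangular, as in [is_trig_mx], with the diagonal as an explicit function: products and
    limits then act on diagonals pointwise. One equation covers the zeros above the diagonal and the
    diagonal itself. *)
Definition ltri n (A : 'M[F]_n) (d : 'I_n -> F) :=
  forall i j : 'I_n, (i <= j)%N -> A i j = d i *+ (i == j).

Lemma ltri_mul n (A B : 'M[F]_n) a b : ltri A a -> ltri B b ->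
  ltri (A *m B) (fun i => a i * b i).
Proof.
move=> hA hB i j ij; rewrite mxE (bigD1 i) //= big1 ?addr0; last first.
  move=> k ki; have [ik|ki'] := ltnP i k.
    by rewrite (hA _ _ (ltnW ik)) eq_sym (negPf ki) mulr0n mul0r.
  rewrite [B k j]hB; last exact: leq_trans ki' ij.
  have -> : (k == j) = false.
    apply/negP => /eqP kj; move: ki; rewrite -(inj_eq val_inj) /= eqn_leq ki' /=.
    by rewrite kj ij.
  by rewrite mulr0n mulr0.
by rewrite hA // hB // eqxx mulr1n mulrnAr.
Qed.

Lemma ltriD n (A B : 'M[F]_n) a b : ltri A a -> ltri B b -> ltri (A + B) (fun i => a i + b i).
Proof. by move=> hA hB i j ij; rewrite mxE hA // hB // -mulrnDl. Qed.

Lemma ltri_scalar n (a : F) : @ltri n a%:M (fun=> a).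
Proof. by move=> i j _; rewrite mxE. Qed.

Lemma ltriX n (A : 'M[F]_n) a k : ltri A a -> ltri (A ^+ k) (fun i => a i ^+ k).
Proof.
move=> hA; elim: k => [|k ih]; first exact: ltri_scalar.
by move=> i j ij; rewrite exprS (ltri_mul hA ih) // exprS.
Qed.

Lemma ltri_trig n (A : 'M[F]_n) a : ltri A a -> is_trig_mx A.
Proof.
move=> hA; apply/is_trig_mxP => i j ij; rewrite (hA _ _ (ltnW ij)).
by rewrite (_ : i == j = false) ?mulr0n // -(inj_eq val_inj) ltn_eqF.
Qed.

Lemma trig_ltri n (A : 'M[F]_n) : is_trig_mx A -> ltri A (fun i => A i i).
Proof.
move=> /is_trig_mxP hA i j; rewrite leq_eqVlt => /orP[/eqP/val_inj -> |ij].
  by rewrite eqxx.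
by rewrite hA // (_ : i == j = false) ?mulr0n // -(inj_eq val_inj) ltn_eqF.
Qed.

Lemma ltri_diag n (A : 'M[F]_n) a i : ltri A a -> A i i = a i.
Proof. by move=> ->; rewrite // eqxx. Qed.

Lemma ltri_unit n (A : 'M[F]_n) a : ltri A a -> (forall i, a i != 0) -> A \in unitmx.
Proof.
move=> hA ha; rewrite unitmxE (det_trig (ltri_trig hA)) unitfE.
by apply/prodf_neq0 => i _; rewrite (ltri_diag i hA).
Qed.

Lemma ltri_eigenvalue n (A : 'M[F]_n) a l : ltri A a ->
  eigenvalue A l = [exists i, l == a i].
Proof.
move=> hA; rewrite eigenvalue_root_char (char_poly_trig (ltri_trig hA)).
rewrite -(big_map (fun i => A i i) xpredT (fun x => 'X - x%:P)) root_prod_XsubC.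
apply/mapP/existsP => [[i _ ->]|[i /eqP ->]]; exists i; rewrite ?(ltri_diag i hA) //.
by rewrite mem_index_enum.
Qed.

Lemma ltri_block m n (a : 'M[F]_m) (b : 'M[F]_n) c (d : 'I_(m + n) -> F) :
  ltri a (fun i => d (lshift n i)) -> ltri b (fun i => d (rshift m i)) ->
  ltri (block_mx a 0 c b) d.
Proof.
move=> ha hb i j; rewrite -[ i ]fintype.splitK -[j]fintype.splitK.
case: (fintype.split i) => i'; case: (fintype.split j) => j' /=.
- by move=> ij; rewrite block_mxEul ha // (inj_eq (@lshift_inj m n)).
- by rewrite block_mxEur mxE eq_lrshift mulr0n.
- by move=> ij; have := ltn_ord j'; rewrite ltnNge (leq_trans _ ij) ?leq_addr.
- by rewrite leq_add2l block_mxEdr => ij; rewrite hb // (inj_eq (@rshift_inj m n)).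
Qed.

Lemma one_block_mx m n : (1 : 'M[F]_(m + n)) = block_mx 1 0 0 1.
Proof. exact: scalar_mx_block. Qed.

Lemma expr_block_lower m n (a : 'M[F]_m) (b : 'M[F]_n) c k :
  (block_mx a 0 c b) ^+ k =
  block_mx (a ^+ k) 0 (dlsubmx ((block_mx a 0 c b) ^+ k)) (b ^+ k).
Proof.
elim: k => [|k ih].
  by rewrite !expr0 one_block_mx block_mxKdl.
rewrite exprS ih -mulmxE mulmx_block block_mxKdl !mulmx0 !mul0mx !addr0 add0r.
by rewrite !exprS.
Qed.

Lemma dlsubmx_expr_block m n (a : 'M[F]_m) (b : 'M[F]_n) c k :
  dlsubmx ((block_mx a 0 c b) ^+ k.+1) =
  dlsubmx ((block_mx a 0 c b) ^+ k) *m a + b ^+ k *m c.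
Proof. by rewrite exprSr {1}expr_block_lower -mulmxE mulmx_block block_mxKdl. Qed.

(** The divided difference (e^k - d^k)/(e - d), that is, the sum of e^i d^j over i + j = k - 1, in a
    form that makes sense at e = d as well. *)
Fixpoint divpow (d e : F) (k : nat) : F :=
  if k is j.+1 then divpow d e j * d + e ^+ j else 0.

Lemma divpowE d e k : (e - d) * divpow d e k = e ^+ k - d ^+ k.
Proof.
elim: k => [|k ih]; first by rewrite /= !expr0 subrr mulr0.
by rewrite /= mulrDr mulrA ih !exprSr; ring.
Qed.

Lemma divpow_diag d k : divpow d d k.+1 = d ^+ k *+ k.+1.
Proof.
elim: k => [|k ih]; first by rewrite /= mul0r add0r.
rewrite [LHS]/= -/(divpow d d k.+1) ih mulrnAl -exprSr.
by rewrite [in RHS]mulrSr.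
Qed.

(** The corner block of the k-th power is the sum of d^j X^i over i + j = k - 1: the divided
    difference of the k-th power at d and X, which acts on the diagonal of X as the scalar one. *)
Lemma ltri_dlsubmx_expr n (d : F) (X : 'M[F]_n) x k : ltri X x ->
  ltri (dlsubmx ((block_mx d%:M 0 1%:M X) ^+ k)) (fun i => divpow d (x i) k).
Proof.
move=> hX; elim: k => [|k ih].
  by rewrite expr0 one_block_mx block_mxKdl => i j _; rewrite mxE mul0rn.
rewrite dlsubmx_expr_block mulmx1; apply: ltriD; last exact: ltriX.
exact: ltri_mul ih (ltri_scalar _).
Qed.

(** Since d is scalar, the corner depends linearly on the column x, through a matrix that does not
    involve x. Hence prescribing the corner of an exponential is a linear system for x. *)
Lemma dlsubmx_expr_colvec n (d : F) (X : 'M[F]_n) (x : 'cV[F]_n) k :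
  dlsubmx ((block_mx (d%:M : 'M[F]_1) 0 x X) ^+ k) =
  dlsubmx ((block_mx (d%:M : 'M[F]_n) 0 1%:M X) ^+ k) *m x.
Proof.
elim: k => [|k ih].
  by rewrite !expr0 !one_block_mx !block_mxKdl mul0mx.
by rewrite !dlsubmx_expr_block ih mulmxDl mulmx1 !mul_mx_scalar scalemxAl.
Qed.

End LowerTriangular.

Section ExistenceLog.
Variable R : realType.
Local Notation C := R[i].

Lemma mexp_block_lower m n (a : 'M[C]_m) (b : 'M[C]_n) c :
  mexp (block_mx a 0 c b) =
  block_mx (mexp a) 0 (dlsubmx (mexp (block_mx a 0 c b))) (mexp b).
Proof.
set Z := block_mx a 0 c b.
have hZ := mexp_cvg Z.
rewrite -[LHS]submxK; congr block_mx.
- apply: (mcvg_unique (u := expsum a)); last exact: mexp_cvg.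
  move=> i j; rewrite 2!mxE; have := hZ (lshift n i) (lshift n j).
  congr ccvg; apply/funext => N; rewrite /expsum !summxE; apply: eq_bigr => k _.
  by rewrite mxE expr_block_lower block_mxEul !mxE.
- apply: (mcvg_unique (u := fun=> 0)); last by move=> i j; exact: ccvg_cst.
  move=> i j; rewrite !mxE; have := hZ (lshift n i) (rshift m j).
  congr ccvg; apply/funext => N; rewrite /expsum !summxE big1 // => k _.
  by rewrite mxE expr_block_lower block_mxEur mxE mulr0.
- apply: (mcvg_unique (u := expsum b)); last exact: mexp_cvg.
  move=> i j; rewrite 2!mxE; have := hZ (rshift m i) (rshift m j).
  congr ccvg; apply/funext => N; rewrite /expsum !summxE; apply: eq_bigr => k _.
  by rewrite mxE expr_block_lower block_mxEdr !mxE.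
Qed.

Lemma dlsubmx_mexp_colvec n (d : C) (X : 'M[C]_n) (x : 'cV[C]_n) :
  dlsubmx (mexp (block_mx (d%:M : 'M[C]_1) 0 x X)) =
  dlsubmx (mexp (block_mx (d%:M : 'M[C]_n) 0 1%:M X)) *m x.
Proof.
set Z1 := block_mx _ _ x _; set Z2 := block_mx _ _ _ _.
have hs N : dlsubmx (expsum Z1 N) = dlsubmx (expsum Z2 N) *m x.
  rewrite /expsum /dlsubmx !linear_sum /= mulmx_suml; apply: eq_bigr => k _.
  by rewrite !linearZ /= -scalemxAl; congr (_ *: _); exact: dlsubmx_expr_colvec.
apply: (mcvg_unique (u := fun N => dlsubmx (expsum Z1 N))) => i j.
  by rewrite 2!mxE; under eq_fun do rewrite 2!mxE; exact: mexp_cvg.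
rewrite mxE; under eq_fun do rewrite hs mxE.
apply: ccvg_sum => k; apply: ccvgM; last exact: ccvg_cst.
by rewrite 2!mxE; under eq_fun do rewrite 2!mxE; exact: mexp_cvg.
Qed.

Lemma ltri_cvg n (u : nat -> 'M[C]_n) L (a : nat -> 'I_n -> C) (l : 'I_n -> C) :
  mcvg u L -> (forall N, ltri (u N) (a N)) -> (forall i, ccvg (a^~ i) (l i)) -> ltri L l.
Proof.
move=> huL hu hl i j ij; apply: (ccvg_unique (huL i j)).
have -> : (fun k => u k i j) = (fun k => a k i *+ (i == j)).
  by apply/funext => N; rewrite hu.
by case: eqP => _; [exact: hl | exact: ccvg_cst].
Qed.

(** The divided difference of exp at d and e, with the derivative as its value at e = d. *)
Definition divexp (d e : C) : C :=
  if e == d then cexp d else (cexp e - cexp d) / (e - d).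

Lemma divexp_cvg (d e : C) :
  ccvg (fun N => \sum_(k < N) (k`!%:R)^-1 * divpow d e k) (divexp d e).
Proof.
rewrite /divexp; case: eqP => [->|/eqP ed].
  have [h1 h2] := cexpsum_cvg d.
  (* The term k = 0 vanishes and the term k + 1 is (k+1) d^k / (k+1)! = d^k / k!, so the sum is the
     exponential series shifted by one index. *)
  have E N : \sum_(k < N.+1) (k`!%:R)^-1 * divpow d d k = cexpsum d N.
    rewrite big_ord_recl [X in X + _]mulr0 add0r; apply: eq_bigr => k _.
    rewrite lift0 divpow_diag factS natrM -[_ ^+ _ *+ _]mulr_natr invfM.
    have a0 : k.+1%:R != 0 :> C by rewrite pnatr_eq0.
    rewrite [_^-1 * _^-1]mulrC -!mulrA; congr (_ * _).
    by rewrite mulrCA mulVf // mulr1.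
  split; rewrite -cvg_shiftS; under eq_fun do rewrite E; [exact: h1|exact: h2].
have ed0 : e - d != 0 by rewrite subr_eq0.
have -> : (fun N => \sum_(k < N) (k`!%:R)^-1 * divpow d e k) =
          (fun N => (cexpsum e N - cexpsum d N) / (e - d)).
  apply/funext => N; apply: (mulfI ed0); rewrite [RHS]mulrC divfK // mulr_sumr.
  rewrite /cexpsum -sumrB; apply: eq_bigr => k _.
  by rewrite mulrCA divpowE mulrBr.
apply: ccvgM; last exact: ccvg_cst.
by apply: ccvgD; [|apply: ccvgN]; exact: cexpsum_cvg.
Qed.

(** This is where the logarithm needs the strip: distinct points that differ by a multiple of 2 pi i
    would make the divided difference vanish. *)
Lemma divexp_neq0 (d e : C) : `|cIm d| < pi -> `|cIm e| < pi -> divexp d e != 0.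
Proof.
move=> hd he; rewrite /divexp; have [_|ed] := eqVneq e d; first exact: cexp_neq0.
rewrite mulf_neq0 ?invr_eq0 ?subr_eq0 //.
by apply: contra ed => /eqP h; apply/eqP; exact: cexp_inj_strip.
Qed.

Lemma ltri_divexp n (d : C) (X : 'M[C]_n) x : ltri X x ->
  ltri (dlsubmx (mexp (block_mx d%:M 0 1%:M X))) (fun i => divexp d (x i)).
Proof.
move=> hX; set Z := block_mx _ _ _ _.
apply: (@ltri_cvg _ (fun N => dlsubmx (expsum Z N)) _
    (fun N i => \sum_(k < N) (k`!%:R)^-1 * divpow d (x i) k)) => [i j|N|i].
- by rewrite 2!mxE; under eq_fun do rewrite 2!mxE; exact: mexp_cvg.
- elim: N => [|N ih].
    by move=> i j _; rewrite /expsum !big_ord0 2!mxE mxE mul0rn.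
  move=> i j ij; rewrite /expsum big_ord_recr /dlsubmx !linearD /= mxE.
  rewrite -/(expsum Z N) -/(dlsubmx (expsum Z N)) ih // !linearZ /= mxE.
  rewrite -/(dlsubmx (Z ^+ N)) (ltri_dlsubmx_expr _ _ hX) // big_ord_recr /=.
  by rewrite mulrnAr -mulrnDl.
- exact: divexp_cvg.
Qed.

(** Split off the first row and column. A logarithm X' of the lower right block is given by
    induction, and for a first column x the corner of the exponential is Phi x, where Phi is
    triangular with diagonal entries [divexp] of the first and the later values of [d]. These are
    nonzero, so x is obtained by inverting Phi. *)
Lemma ltri_log n (T : 'M[C]_n) (d : 'I_n -> C) : ltri T (fun i => cexp (d i)) ->
  (forall i, `|cIm (d i)| < pi) -> exists2 X, ltri X d & mexp X = T.
Proof.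
elim: n => [|n ih] in T d * => hT hd.
  by exists 0; [case|apply/matrixP; case].
pose T' : 'M[C]_(1 + n) := T.
pose d' (i : 'I_n) := d (rshift 1 i).
have hT' : ltri (drsubmx T') (fun i => cexp (d' i)).
  move=> i j ij; rewrite 2!mxE hT ?leq_add2l //; congr (_ *+ nat_of_bool _).
have [X' hX' eX'] := ih _ d' hT' (fun i => hd _).
pose d0 := d (lshift n (0 : 'I_1)); pose Phi := dlsubmx (mexp (block_mx d0%:M 0 1%:M X')).
have hPhi : Phi \in unitmx.
  by apply: (ltri_unit (ltri_divexp d0 hX')) => i; apply: divexp_neq0; exact: hd.
pose X : 'M[C]_(1 + n) := block_mx d0%:M 0 (invmx Phi *m dlsubmx T') X'.
exists X.
  apply: (@ltri_block _ 1 n _ _ _ d) => //.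
  by move=> i j _; rewrite mxE !ord1 eqxx.
have hur : ursubmx T' = 0.
  by apply/matrixP => i j; rewrite 2!mxE hT ?mxE ?eq_lrshift ?mulr0n //= ord1.
have hul : ulsubmx T' = mexp d0%:M.
  rewrite -diag_const_mx mexp_diag; apply/matrixP => i j.
  by rewrite !ord1 !mxE eqxx mulr1n hT // eqxx.
suff : @mexp R (1 + n) X = T' by [].
rewrite /X mexp_block_lower dlsubmx_mexp_colvec mulKVmx // eX'.
by rewrite -[RHS](@submxK _ 1 n 1 n T') hur hul.
Qed.

End ExistenceLog.

(** * Approximation by diagonalizable matrices *)

Section Approximation.
Variable R : realType.
Local Notation C := R[i].

Lemma eigenvalue_similar n (P A B : 'M[C]_n) l : P \in unitmx ->
  A = invmx P *m B *m P -> eigenvalue A l = eigenvalue B l.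
Proof.
move=> Pu ->; apply/eigenvalueP/eigenvalueP => -[v hv v0].
  exists (v *m invmx P).
    by rewrite scalemxAl -hv !mulmxA mulmxK.
  apply: contra v0 => /eqP h.
  by rewrite -(mulmxKV Pu v) h mul0mx.
exists (v *m P).
  by rewrite !mulmxA mulmxK // hv scalemxAl.
by apply: contra v0 => /eqP h; rewrite -(mulmxK Pu v) h mul0mx.
Qed.

Lemma triangularization n (A : 'M[C]_n) :
  exists P T, [/\ P \in unitmx, is_trig_mx T & A = invmx P *m T *m P].
Proof.
case: n => [|n] in A *.
  exists 1%:M, A; split; rewrite ?unitmx1 //; last by apply/matrixP; case.
  by apply/is_trig_mxP; case.
have [P Pu hT] := Schur A (ltn0Sn n); have Pun := unitarymx_unit Pu.
exists P, (P *m A *m invmx P); split => //; first by rewrite -conjumx.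
by rewrite !mulmxA mulVmx // mul1mx mulmxKV.
Qed.

Lemma exists_log n (A : 'M[C]_n) : (forall l, eigenvalue A l -> 0 < cRe l) ->
  exists2 X, mexp X = A & forall l, eigenvalue X l -> `|cIm l| < pi.
Proof.
move=> hA; have [P [T [Pu hT AE]]] := triangularization A.
have hd i : exists2 z, cexp z = T i i & `|cIm z| < pi / 2.
  apply: cexp_surj_right; apply: hA; rewrite (eigenvalue_similar _ Pu AE).
  by rewrite (ltri_eigenvalue _ (trig_ltri hT)); apply/existsP; exists i.
pose d i := sval (cid2 (hd i)).
have dE i : cexp (d i) = T i i by rewrite /d; case: cid2.
have dI i : `|cIm (d i)| < pi.
  rewrite /d; case: cid2 => z /= _ h; apply: lt_trans h _.
  by rewrite ltr_pdivrMr // mulr2n mulrDr mulr1 ltrDl pi_gt0.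
have [X hX eX] : exists2 X, ltri X d & mexp X = T.
  apply: ltri_log => // i j ij; rewrite (trig_ltri hT) // dE //.
exists (invmx P *m X *m P).
  by rewrite mexp_conj ?mulmxV // eX -AE.
move=> l; rewrite (eigenvalue_similar _ Pu erefl) (ltri_eigenvalue _ hX).
by move=> /existsP[i /eqP ->].
Qed.

(** The minimal polynomial divides the characteristic one, which is a product of distinct linear
    factors. *)
Lemma ltri_distinct_diagonalizable n (T : 'M[C]_n) (d : 'I_n -> C) : ltri T d ->
  injective d -> exists V e, V \in unitmx /\ T = invmx V *m diag_mx e *m V.
Proof.
case: n => [|n] in T d *.
  by exists 1%:M, 0; split; [rewrite unitmx1|apply/matrixP; case].
move=> hT dI.
have /diagonalizableP[V Vu hV] : exists2 rs, uniq rs & mxminpoly T %| \prod_(x <- rs) ('X - x%:P).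
  exists [seq d i | i <- index_enum 'I_n.+1].
    by rewrite map_inj_uniq // index_enum_uniq.
  rewrite big_map (_ : \prod_i _ = char_poly T) ?mxminpoly_dvd_char //.
  rewrite (char_poly_trig (ltri_trig hT)); apply: eq_bigr => i _.
  by rewrite (ltri_diag i hT).
have hD (i j : 'I_n.+1) : i != j :> nat -> conjmx V T i j = 0.
  by move: i j; apply/is_diag_mxP; exact: hV.
exists V, (\row_i (conjmx V T i i)); split => //.
have -> : diag_mx (\row_i conjmx V T i i) = conjmx V T.
  apply/matrixP => i j; rewrite [LHS]mxE [X in X *+ _]mxE.
  case: eqP => [->|/eqP ij]; first by rewrite mulr1n.
  by rewrite mulr0n; rewrite hD // (inj_eq val_inj).
by rewrite conjumx // !mulmxA mulVmx // mul1mx mulmxKV.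
Qed.

(** Add e diag(0, 1, ..., n-1) to a triangular form. For small e > 0 the diagonal entries become
    distinct, and since e is real their imaginary parts do not change, so the strip condition
    survives exactly. *)
Lemma approx_diag n (X : 'M[C]_n) (eps : R) : 0 < eps ->
  (forall l, eigenvalue X l -> `|cIm l| < pi) ->
  exists (V W : 'M[C]_n) (d : 'rV[C]_n), [/\ V *m W = 1%:M,
    forall i, `|cIm (d 0 i)| < pi & nrm1 (V *m diag_mx d *m W - X) < eps].
Proof.
move=> eps0 hX; have [P [T [Pu hT XE]]] := triangularization X.
pose K := nrm1 (invmx P *m diag_mx (\row_(i < n) (i%:R : C)) *m P).
have hK : \forall e \near (0 : R)^'+, e < eps / (K + 1).
  by apply: nbhs_right_lt; rewrite divr_gt0 // ltr_wpDl ?nrm1_ge0.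
(* Equal entries are separated by every e > 0. For different entries a collision would give |T i i -
   T j j| = e |j - i| <= e n, which fails for small e. *)
have hpair (i j : 'I_n) : \forall e \near (0 : R)^'+,
    T i i + e%:C * i%:R = T j j + e%:C * j%:R -> i = j.
  have [Tij|Tij] := eqVneq (T i i) (T j j).
    near=> e => /eqP; rewrite Tij (inj_eq (addrI _)) (inj_eq (mulfI _)).
      by rewrite eqr_nat => /eqP/val_inj.
    by rewrite (inj_eq (@complexI R)) gt_eqF.
  have m0 : 0 < cmod (T i i - T j j).
    by rewrite lt_neqAle cmod_ge0 eq_sym cmod_eq0 subr_eq0 Tij.
  have n0 : 0 < n%:R :> R by rewrite ltr0n (leq_trans _ (ltn_ord i)).
  near=> e => h; exfalso.
  have e0 : 0 < e by near: e; exact: nbhs_right_gt.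
  have : e < cmod (T i i - T j j) / n%:R.
    by near: e; apply: nbhs_right_lt; rewrite divr_gt0.
  rewrite ltr_pdivlMr // ltNge => /negP; apply.
  have -> : T i i - T j j = e%:C * (j%:R - i%:R)%:C.
    by rewrite rmorphB /= -!natr_realC mulrBr -(addrK (e%:C * i%:R) (T i i)) h; ring.
  rewrite cmodM !cmodR gtr0_norm // (ler_wpM2l (ltW e0)) //.
  have hi : (i%:R : R) <= n%:R by rewrite ler_nat ltnW.
  have hj : (j%:R : R) <= n%:R by rewrite ler_nat ltnW.
  have hi0 : 0 <= (i%:R : R) by [].
  have hj0 : 0 <= (j%:R : R) by [].
  by rewrite ler_norml; apply/andP; split; lra.
have : \forall e \near (0 : R)^'+, [/\ 0 < e, e < eps / (K + 1)
    & forall i j : 'I_n, T i i + e%:C * i%:R = T j j + e%:C * j%:R -> i = j].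
  near=> e; split.
  - by near: e; exact: nbhs_right_gt.
  - by near: e.
  - move=> i j; move: i j; near: e; apply: filter_forall => i.
    by apply: filter_forall => j; exact: hpair.
move/filter_ex => [e [e0 eK edist]].
pose D := diag_mx (\row_(i < n) (i%:R : C)).
have hTe : ltri (T + e%:C *: D) (fun i => T i i + e%:C * i%:R).
  move=> i j ij; rewrite !mxE (trig_ltri hT) //.
  by rewrite [RHS]mulrnDl; congr (_ + _); exact: mulrnAr.
have [V [d [Vu TE]]] := ltri_distinct_diagonalizable hTe edist.
exists (invmx P *m invmx V), (V *m P), d; split.
- by rewrite mulmxA mulmxKV // mulVmx.
- move=> i; have : eigenvalue (T + e%:C *: D) (d 0 i).
    rewrite (eigenvalue_similar _ Vu TE).
    rewrite (@ltri_eigenvalue _ _ _ (fun i => d 0 i)); first by apply/existsP; exists i.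
    by move=> k l _; rewrite mxE; case: eqP => // ->.
  rewrite (ltri_eigenvalue _ hTe) => /existsP[j /eqP ->].
  rewrite cImD cImM /= natr_realC /= mul0r mulr0 !addr0.
  apply: hX; rewrite (eigenvalue_similar _ Pu XE) (ltri_eigenvalue _ (trig_ltri hT)).
  by apply/existsP; exists j.
- have -> : invmx P *m invmx V *m diag_mx d *m (V *m P) - X =
      e%:C *: (invmx P *m D *m P).
    have -> : invmx P *m invmx V *m diag_mx d *m (V *m P) =
      invmx P *m (invmx V *m diag_mx d *m V) *m P by rewrite !mulmxA.
    rewrite -TE mulmxDr mulmxDl XE addrAC subrr add0r.
    by rewrite -scalemxAr -scalemxAl.
  rewrite nrm1Z cmodR gtr0_norm // (le_lt_trans (y := e * (K + 1))) //.
    by rewrite ler_wpM2l ?ltW // ltrDl.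
  by rewrite -ltr_pdivlMr // ltr_wpDl ?nrm1_ge0.
Unshelve. all: by end_near. Qed.

End Approximation.

(** * Geometric means and lower bounds on real parts *)

Section Forms.
Variable R : realType.
Local Notation C := R[i].

Definition sqnorm n (x : 'cV[C]_n) : R := \sum_i cmod (x i 0) ^+ 2.

Definition reform n (A : 'M[C]_n) (x : 'cV[C]_n) : R := cRe (cdot (A *m x) x).

Lemma sqnorm_ge0 n (x : 'cV[C]_n) : 0 <= sqnorm x.
Proof. by apply: sumr_ge0 => i _; rewrite sqr_ge0. Qed.

Lemma cdotxx n (x : 'cV[C]_n) : cdot x x = (sqnorm x)%:C.
Proof.
by rewrite /cdot /sqnorm rmorph_sum; apply: eq_bigr => i _; rewrite mulJ_Re.
Qed.

Lemma cdotDl n (x y z : 'cV[C]_n) : cdot (x + y) z = cdot x z + cdot y z.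
Proof. by rewrite /cdot -big_split; apply: eq_bigr => i _; rewrite mxE mulrDl. Qed.

Lemma cdotDr n (x y z : 'cV[C]_n) : cdot z (x + y) = cdot z x + cdot z y.
Proof.
by rewrite /cdot -big_split; apply: eq_bigr => i _; rewrite mxE rmorphD mulrDr.
Qed.

Lemma cdotZl n a (x y : 'cV[C]_n) : cdot (a *: x) y = a * cdot x y.
Proof. by rewrite /cdot mulr_sumr; apply: eq_bigr => i _; rewrite mxE mulrA. Qed.

Lemma cdotZr n a (x y : 'cV[C]_n) : cdot x (a *: y) = conjc a * cdot x y.
Proof.
by rewrite /cdot mulr_sumr; apply: eq_bigr => i _; rewrite mxE rmorphM mulrCA.
Qed.

Lemma cdotC n (x y : 'cV[C]_n) : cdot y x = (cdot x y)^*.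
Proof.
rewrite /cdot rmorph_sum; apply: eq_bigr => i _.
by rewrite rmorphM /= conjcK mulrC.
Qed.

Lemma reformD n (A B : 'M[C]_n) x : reform (A + B) x = reform A x + reform B x.
Proof. by rewrite /reform mulmxDl cdotDl cReD. Qed.

Lemma reformZ n (r : R) (A : 'M[C]_n) x : reform (r%:C *: A) x = r * reform A x.
Proof. by rewrite /reform -scalemxAl cdotZl cReM /= mul0r subr0. Qed.

Lemma reform1 n (x : 'cV[C]_n) : reform 1%:M x = sqnorm x.
Proof. by rewrite /reform mul1mx cdotxx. Qed.

Lemma reform_bound n (A : 'M[C]_n) x : `|reform A x| <= nrm1 A * sqnorm x.
Proof.
rewrite (le_trans (cRe_le_cmod _)) // /cdot (le_trans (cmod_sum _ _ _)) //.
rewrite /nrm1 mulr_suml; apply: ler_sum => i _.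
rewrite cmodM cmodJ mxE.
apply: (@le_trans _ _ ((\sum_j cmod (A i j * x j 0)) * cmod (x i 0))).
  by rewrite ler_wpM2r ?cmod_ge0 ?cmod_sum.
rewrite !mulr_suml; apply: ler_sum => j _; rewrite cmodM -mulrA ler_wpM2l ?cmod_ge0 //.
have hk k : cmod (x k 0) ^+ 2 <= sqnorm x.
  rewrite /sqnorm (bigD1 k) //= lerDl; apply: sumr_ge0 => l _; exact: sqr_ge0.
by have := hk i; have := hk j; have := sqr_ge0 (cmod (x i 0) - cmod (x j 0)); nra.
Qed.

(* For a unitary [U] this is <U^* diag(p) U x, x>. *)
Definition wsq n (U : 'M[C]_n) (p : 'I_n -> R) (x : 'cV[C]_n) : R :=
  \sum_i p i * cmod ((U *m x) i 0) ^+ 2.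

(** For unitary [U] this is the order Re A >= U^* diag(p) U of Hermitian matrices. With [U] fixed,
    only the weights change along the proof. *)
Definition dominates n (U : 'M[C]_n) (A : 'M[C]_n) (p : 'I_n -> R) :=
  forall x, wsq U p x <= reform A x.

Lemma wsq_le n (U : 'M[C]_n) p q x : (forall i, p i <= q i) -> wsq U p x <= wsq U q x.
Proof. by move=> h; apply: ler_sum => i _; rewrite ler_wpM2r ?sqr_ge0. Qed.

Lemma dominates_arith n (U B D : 'M[C]_n) p q : dominates U B p -> dominates U D q ->
  dominates U ((2^-1)%:C *: (B + D)) (fun i => (p i + q i) / 2).
Proof.
move=> hB hD x; rewrite reformZ reformD mulrC -ler_pdivrMr ?invr_gt0 // invrK.
rewrite (le_trans _ (lerD (hB x) (hD x))) // /wsq mulr_suml -big_split.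
by apply: ler_sum => i _ /=; lra.
Qed.

(** With s = |a| and t = |b|, clearing the denominator leaves the defect (p s - q t)^2 after the
    triangle inequality. *)
Lemma parallel_sum_le (p q : R) (a b : C) : 0 < p -> 0 < q ->
  p * q / (p + q) * cmod (a + b) ^+ 2 <= p * cmod a ^+ 2 + q * cmod b ^+ 2.
Proof.
move=> p0 q0; have pq : 0 < p + q by rewrite addr_gt0.
apply: (@le_trans _ _ (p * q / (p + q) * (cmod a + cmod b) ^+ 2)).
  apply: ler_wpM2l; first by rewrite ltW // divr_gt0 // mulr_gt0.
  by rewrite lerXn2r ?nnegrE ?addr_ge0 ?cmod_ge0 ?cmodD.
rewrite mulrAC ler_pdivrMr //.
move: (cmod a) (cmod b) => s t.
have := sqr_ge0 (p * s - q * t); nra.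
Qed.

(** The hypotheses encode, without inverses, the parallel sum H of B and D, with S = B^-1 H and T =
    D^-1 H. From x = Sx + Tx one gets <Hx,x> = <B Sx, Sx> + <D Tx, Tx>, and the scalar inequality
    applies in each coordinate. *)
Lemma dominates_harmonic n (U B D H S T : 'M[C]_n) p q :
  (forall i, 0 < p i) -> (forall i, 0 < q i) ->
  dominates U B p -> dominates U D q ->
  S + T = 1%:M -> B *m S = H -> D *m T = H ->
  dominates U (2%:R *: H) (fun i => 2 * (p i * q i / (p i + q i))).
Proof.
move=> p0 q0 hB hD ST BS DT x.
have -> : reform (2%:R *: H) x = 2 * (reform B (S *m x) + reform D (T *m x)).
  rewrite natr_realC reformZ; congr (_ * _).
  rewrite /reform !mulmxA BS DT -cReD -cdotDr -mulmxDl ST mul1mx //.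
apply: (@le_trans _ _ (2 * (wsq U p (S *m x) + wsq U q (T *m x)))); last first.
  by rewrite ler_wpM2l // lerD.
rewrite /wsq -big_split mulr_sumr; apply: ler_sum => i _ /=.
rewrite -[X in X <= _]mulrA ler_wpM2l //.
have -> : (U *m x) i 0 = (U *m (S *m x)) i 0 + (U *m (T *m x)) i 0.
  by rewrite -[in LHS](mul1mx x) -ST mulmxDl mulmxDr mxE.
exact: parallel_sum_le.
Qed.

End Forms.

Section GeometricMean.
Variables (R : realType) (n : nat) (V W U : 'M[R[i]]_n).
Hypothesis VW : V *m W = 1%:M.
Local Notation C := R[i].

(** The functional calculus of matrices diagonal in one fixed basis: as W is the inverse of V, sums
    and products are taken pointwise on [f]. *)
Definition dmx (f : 'I_n -> C) : 'M[C]_n := V *m diag_mx (\row_i f i) *m W.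

Lemma dmxM f g : dmx f *m dmx g = dmx (fun i => f i * g i).
Proof.
have WV : W *m V = 1%:M by exact: mulmx1C.
rewrite /dmx !mulmxA -[_ *m W *m V]mulmxA WV mulmx1 -[_ *m diag_mx _ *m diag_mx _]mulmxA.
rewrite mulmx_diag; congr (_ *m diag_mx _ *m _).
by apply/rowP => i; rewrite !mxE.
Qed.

Lemma dmxD f g : dmx f + dmx g = dmx (fun i => f i + g i).
Proof.
rewrite /dmx -mulmxDl -mulmxDr -raddfD; congr (_ *m diag_mx _ *m _).
by apply/rowP => i; rewrite !mxE.
Qed.

Lemma dmxZ a f : a *: dmx f = dmx (fun i => a * f i).
Proof.
rewrite /dmx scalemxAl scalemxAr -linearZ; congr (_ *m diag_mx _ *m _).
by apply/rowP => i; rewrite !mxE.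
Qed.

Lemma dmx1 : dmx (fun=> 1) = 1%:M.
Proof.
rewrite /dmx (_ : \row__ _ = const_mx 1); last by apply/rowP => i; rewrite !mxE.
by rewrite diag_const_mx mulmx1.
Qed.

Lemma eq_dmx f g : f =1 g -> dmx f = dmx g.
Proof. by move=> /funext ->. Qed.

Lemma dominates_dmx f g p : f =1 g -> dominates U (dmx f) p -> dominates U (dmx g) p.
Proof. by move=> /funext ->. Qed.

Definition dmx_coef (x y : 'cV[C]_n) (i : 'I_n) : C :=
  (W *m x) i 0 * \sum_j V j i * (y j 0)^*.

(** The form is linear in [f] with coefficients that do not depend on it, so matrix limits reduce to
    finitely many scalar limits. *)
Lemma cdot_dmx f x y : cdot (dmx f *m x) y = \sum_i f i * dmx_coef x y i.
Proof.
rewrite /cdot /dmx -!mulmxA.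
under eq_bigr do rewrite mxE mulr_suml.
rewrite exchange_big; apply: eq_bigr => i _.
rewrite /dmx_coef mulrA mulr_sumr; apply: eq_bigr => j _.
by rewrite mul_diag_mx mxE [X in X * _ 0]mxE; ring.
Qed.

Lemma reform_dmx_cvg (f : nat -> 'I_n -> C) g x :
  (forall i, ccvg (f^~ i) (g i)) ->
  (fun k => reform (dmx (f k)) x) @ \oo --> reform (dmx g) x.
Proof.
move=> h; rewrite /reform cdot_dmx; under eq_fun do rewrite cdot_dmx.
suff [] : ccvg (fun k => \sum_i f k i * dmx_coef x x i) (\sum_i g i * dmx_coef x x i) by [].
by apply: ccvg_sum => i; apply: ccvgM => //; exact: ccvg_cst.
Qed.

(** A coordinate that linearises the iteration: the pair at w and -w has product g^2, and its
    arithmetic and harmonic means are the pair at w^2 and -w^2. *)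
Definition mobius (g w : C) : C := g * (1 + w) / (1 - w).

Lemma add1_neq0 (w : C) : cmod w < 1 -> 1 + w != 0.
Proof.
move=> h; apply/eqP => /eqP; rewrite addrC addr_eq0 => /eqP hw.
by move: h; rewrite hw cmodN cmod1 ltxx.
Qed.

Lemma sub1_neq0 (w : C) : cmod w < 1 -> 1 - w != 0.
Proof. by move=> h; apply: add1_neq0; rewrite cmodN. Qed.

Lemma cmod_sqr_lt1 (w : C) : cmod w < 1 -> cmod (w ^+ 2) < 1.
Proof. by move=> h; rewrite cmodX expr_lt1 // cmod_ge0. Qed.

Lemma dominates_mean_step (g w : 'I_n -> C) p q :
  (forall i, cmod (w i) < 1) -> (forall i, 0 < p i) -> (forall i, 0 < q i) ->
  dominates U (dmx (fun i => mobius (g i) (w i))) p ->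
  dominates U (dmx (fun i => mobius (g i) (- w i))) q ->
  dominates U (dmx (fun i => mobius (g i) (w i ^+ 2))) (fun i => (p i + q i) / 2) /\
  dominates U (dmx (fun i => mobius (g i) (- w i ^+ 2)))
    (fun i => 2 * (p i * q i / (p i + q i))).
Proof.
move=> hw p0 q0 hB hD.
have n1 i : 1 + w i != 0 by exact: add1_neq0.
have n2 i : 1 - w i != 0 by exact: sub1_neq0.
have n3 i : 1 + w i ^+ 2 != 0 by apply: add1_neq0; exact: cmod_sqr_lt1.
have n4 i : 1 - w i ^+ 2 != 0 by apply: sub1_neq0; exact: cmod_sqr_lt1.
split.
  have := dominates_arith hB hD; rewrite dmxD dmxZ; apply: dominates_dmx => i; rewrite /mobius opprK.
  have -> : (2^-1)%:C = 2^-1 :> C by rewrite fmorphV natr_realC.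
  by field; rewrite n1 n2 n4.
(* For the pair B, D these are s = D/(B+D), t = B/(B+D) and h = BD/(B+D), simplified so that no
   division by g occurs. *)
pose s i := (1 - w i) ^+ 2 / (2 * (1 + w i ^+ 2)).
pose t i := (1 + w i) ^+ 2 / (2 * (1 + w i ^+ 2)).
pose h i := g i * (1 - w i ^+ 2) / (2 * (1 + w i ^+ 2)).
have := @dominates_harmonic _ _ U _ _ (dmx h) (dmx s) (dmx t) _ _ p0 q0 hB hD.
rewrite dmxZ !dmxM dmxD -dmx1.
have -> : dmx (fun i => 2%:R * h i) = dmx (fun i => mobius (g i) (- w i ^+ 2)).
  by apply: eq_dmx => i; rewrite /h /mobius opprK; field.
apply.
- by apply: eq_dmx => i; rewrite /s /t; field.
- by apply: eq_dmx => i; rewrite /s /h /mobius; field; rewrite n2 n3.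
- by apply: eq_dmx => i; rewrite /t /h /mobius opprK; field; rewrite n1 n3.
Qed.

Lemma mobius_cvg (g w : C) : cmod w < 1 ->
  ccvg (fun k => mobius g (w ^+ (2 ^ k))) g.
Proof.
move=> hw; apply/ccvg_cmod.
have w0 := cmod_ge0 w.
have hp k : cmod (w ^+ (2 ^ k)) <= cmod w ^+ k.
  by rewrite cmodX; apply: ler_wiXn2l => //; [exact: ltW | exact/ltnW/ltn_expl].
have hp1 k : cmod (w ^+ (2 ^ k)) <= cmod w.
  rewrite cmodX -[leRHS]expr1; apply: ler_wiXn2l => //; first exact: ltW.
  by rewrite expn_gt0.
have hlim : (fun k => 2 * cmod g / (1 - cmod w) * cmod w ^+ k) @ \oo --> (0 : R).
  rewrite -[X in _ --> X](mulr0 (2 * cmod g / (1 - cmod w))); apply: cvgMr.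
  by apply: cvg_expr; rewrite ger0_norm.
apply: (squeeze_cvgr _ (cvg_cst 0) hlim); near=> k; rewrite cmod_ge0 /=.
set v := w ^+ (2 ^ k).
have hv : cmod v < 1 by rewrite (le_lt_trans (hp1 k)).
have -> : mobius g v - g = 2 * g * v / (1 - v).
  by rewrite /mobius; field; exact: sub1_neq0.
rewrite !cmodM cmodV natr_realC cmodR ger0_norm //.
rewrite -!mulrA ler_wpM2l // ler_wpM2l ?cmod_ge0 // mulrC.
have h1 : 1 - cmod w <= cmod (1 - v).
  have := cmodD (1 - v) v; rewrite subrK cmod1; have := hp1 k; rewrite -/v; lra.
have h0 : 0 < 1 - cmod w by rewrite subr_gt0.
rewrite ler_pM ?cmod_ge0 ?invr_ge0 ?cmod_ge0 ?hp //.
by rewrite lef_pV2 // posrE // (lt_le_trans h0).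
Unshelve. all: by end_near. Qed.

Lemma cmod_cayley_lt1 (e : C) : 0 < cRe e -> cmod ((e - 1) / (e + 1)) < 1.
Proof.
move=> he.
have e1 : e + 1 != 0.
  apply/eqP => h; move: (congr1 (@complex.Re R) h).
  by rewrite cReD /= => /eqP; rewrite gt_eqF // addr_gt0.
have c1 : 0 < cmod (e + 1) by rewrite lt_neqAle cmod_ge0 eq_sym cmod_eq0 e1.
rewrite cmodM cmodV ltr_pdivrMr // mul1r.
rewrite -(@ltr_pXn2r _ 2) ?nnegrE ?cmod_ge0 // !cmod_sqr !cReD !cImD !cReN !cImN /=.
by rewrite oppr0 !addr0 ltrD2r; nra.
Qed.

(** The matrix iterates tend to [dmx g], while the weights undergo the same real iteration, whose
    product stays p q = s^2. By the inequality of means every arithmetic iterate thus has weights at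
    least s, and this bound passes to the limit. *)
Lemma dominates_geometric_mean (g e : 'I_n -> C) p q s :
  (forall i, 0 < cRe (e i)) -> (forall i, 0 < p i) -> (forall i, 0 < q i) ->
  (forall i, s i ^+ 2 = p i * q i) ->
  dominates U (dmx (fun i => g i * e i)) p ->
  dominates U (dmx (fun i => g i / e i)) q ->
  dominates U (dmx g) s.
Proof.
move=> he p0 q0 hs hB hD.
(* The Cayley transform solves e = (1 + w)/(1 - w), so g e and g / e are the pair at w and -w; Re e
   > 0 means |w| < 1. *)
pose w i := (e i - 1) / (e i + 1).
have hw i : cmod (w i) < 1 by exact: cmod_cayley_lt1.
have e0 i : e i != 0 by apply/eqP => h; move: (he i); rewrite h ltxx.
have e1 i : e i + 1 != 0.
  apply/eqP => h; move: (congr1 (@complex.Re R) h).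
  by rewrite cReD /= => /eqP; rewrite gt_eqF // addr_gt0.
have hk k : exists p' q' : 'I_n -> R,
    [/\ forall i, 0 < p' i, forall i, 0 < q' i, forall i, p' i * q' i = p i * q i,
      dominates U (dmx (fun i => mobius (g i) (w i ^+ (2 ^ k)))) p' &
      dominates U (dmx (fun i => mobius (g i) (- w i ^+ (2 ^ k)))) q'].
  elim: k => [|k [p' [q' [hp' hq' hpq hB' hD']]]].
    exists p, q; split; [exact: p0|exact: q0|by []| |].
      apply: dominates_dmx hB => i; rewrite expn0 expr1 /mobius /w.
      field; rewrite e1 (_ : e i + 1 - (e i - 1) = 2%:R) ?pnatr_eq0 //; ring.
    apply: dominates_dmx hD => i; rewrite expn0 expr1 /mobius /w.
    field; rewrite e1 e0 andbT (_ : e i + 1 - - (e i - 1) = e i *+ 2); last ring.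
    by rewrite mulrn_eq0 /= e0.
  have hwk i : cmod (w i ^+ (2 ^ k)) < 1.
    by rewrite cmodX exprn_ilt1 ?cmod_ge0 // -lt0n expn_gt0.
  have [h1 h2] := dominates_mean_step hwk hp' hq' hB' hD'.
  exists (fun i => (p' i + q' i) / 2), (fun i => 2 * (p' i * q' i / (p' i + q' i))).
  have pq0 i : 0 < p' i + q' i by rewrite addr_gt0.
  split.
  - by move=> i; rewrite divr_gt0.
  - by move=> i; rewrite mulr_gt0 // divr_gt0 // mulr_gt0.
  - by move=> i; rewrite -hpq; field; rewrite gt_eqF.
  - by apply: dominates_dmx h1 => i; rewrite -exprM expnSr.
  - by apply: dominates_dmx h2 => i; rewrite -exprM expnSr.
(* The index [k.+1] appears because the inequality of means holds for the arithmetic mean formed by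
   one more step. *)
have hlow k x : wsq U s x <= reform (dmx (fun i => mobius (g i) (w i ^+ (2 ^ k.+1)))) x.
  have [p' [q' [hp' hq' hpq hB' hD']]] := hk k.
  have hwk i : cmod (w i ^+ (2 ^ k)) < 1.
    by rewrite cmodX exprn_ilt1 ?cmod_ge0 // -lt0n expn_gt0.
  have [h1 _] := dominates_mean_step hwk hp' hq' hB' hD'.
  have := h1 x; under eq_dmx do rewrite -exprM -expnSr; apply: le_trans.
  apply: wsq_le => i; rewrite ler_pdivlMr //.
  have := hs i; rewrite -hpq; have := hp' i; have := hq' i => q1 p1 h.
  have : (s i * 2) ^+ 2 <= (p' i + q' i) ^+ 2.
    by have := sqr_ge0 (p' i - q' i); nra.
  by have [s0|s0] := ltP (s i) 0; [nra | rewrite ler_pXn2r // nnegrE ?mulr_ge0 ?addr_ge0 // ltW].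
move=> x.
have hlim : (fun k => reform (dmx (fun i => mobius (g i) (w i ^+ (2 ^ k)))) x) @ \oo --> reform (dmx g) x.
  by apply: reform_dmx_cvg => i; exact: mobius_cvg.
move: hlim; rewrite -cvg_shiftS => hlim.
apply: (ler_cvg_to (cvg_cst (wsq U s x)) hlim); near=> k; exact: hlow.
Unshelve. all: by end_near. Qed.

End GeometricMean.

(** * Density of exponents obtained by bisection *)

Section Midpoint.
Variable R : realType.

Lemma midpoint_closed_bisect (P : R -> Prop) (t : R) k : P 0 -> P 1 ->
  (forall a b, 0 <= a <= 1 -> 0 <= b <= 1 -> P a -> P b -> P ((a + b) / 2)) ->
  0 <= t <= 1 ->
  exists a b, [/\ 0 <= a, b <= 1, a <= t <= b, b - a = 2^-1 ^+ k & P a /\ P b].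
Proof.
move=> P0 P1 Pm /andP[t0 t1]; elim: k => [|k [a [b [a0 b1 /andP[ha hb] hab [Pa Pb]]]]].
  by exists 0, 1; rewrite t0 t1 expr0 subr0.
have Pc : P ((a + b) / 2) by apply: Pm => //; apply/andP; split; lra.
have [ht|ht] := leP t ((a + b) / 2).
  exists a, ((a + b) / 2); split; rewrite ?ha ?ht ?exprS -?hab //; lra.
exists ((a + b) / 2), b; split; rewrite ?hb ?(ltW ht) ?exprS -?hab //; lra.
Qed.

(** Bisection keeps t between two points of P at distance 2^-k. No closedness is assumed: the
    passage to the limit is left to the use of the sequence. *)
Lemma midpoint_closed_cvg (P : R -> Prop) (t : R) : P 0 -> P 1 ->
  (forall a b, 0 <= a <= 1 -> 0 <= b <= 1 -> P a -> P b -> P ((a + b) / 2)) ->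
  0 <= t <= 1 -> exists2 u : nat -> R, forall k, P (u k) & u @ \oo --> t.
Proof.
move=> P0 P1 Pm ht.
have h k : exists a, `|a - t| <= 2^-1 ^+ k /\ P a.
  have [a [b [a0 b1 /andP[ha hb] hab [Pa Pb]]]] := midpoint_closed_bisect k P0 P1 Pm ht.
  exists a; split => //; rewrite distrC ger0_norm ?subr_ge0 // -hab; lra.
have [u hu] := choice h; exists u => [k|]; first by have [] := hu k.
apply/subr_cvg0; apply/norm_cvg0P.
have hlim : (fun k => (2^-1 : R) ^+ k) @ \oo --> (0 : R).
  by apply: cvg_expr; rewrite ger0_norm ?invr_ge0 // invf_lt1 // ltr1n.
apply: (squeeze_cvgr _ (cvg_cst 0) hlim); near=> k.
by rewrite normr_ge0 /=; have [] := hu k.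
Unshelve. all: by end_near. Qed.

End Midpoint.

Section PowersDiagonalizable.
Variables (R : realType) (n : nat) (V W U : 'M[R[i]]_n).
Hypothesis VW : V *m W = 1%:M.
Local Notation C := R[i].

Lemma mexp_dmx f : mexp (dmx V W f) = dmx V W (fun i => cexp (f i)).
Proof.
rewrite /dmx mexp_conj ?mexp_diag; last exact: mulmx1C.
by congr (_ *m diag_mx _ *m _); apply/rowP => i; rewrite !mxE.
Qed.

Lemma cexp_cvg (z : C) (u : nat -> R) (t : R) : u @ \oo --> t ->
  ccvg (fun k => cexp ((u k)%:C * z)) (cexp (t%:C * z)).
Proof.
move=> hu.
have hv (a : R) : (fun k => u k * a) @ \oo --> t * a.
  by apply: cvgM => //; exact: cvg_cst.
have hRe s : cRe (s%:C * z) = s * cRe z by rewrite cReM /= mul0r subr0.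
have hIm s : cIm (s%:C * z) = s * cIm z by rewrite cImM /= mul0r addr0.
rewrite /cexp; split => /=; rewrite hRe hIm; under eq_fun do rewrite hRe hIm.
  apply: cvgM; first exact: (continuous_cvg _ (@continuous_expR R _) (hv _)).
  exact: (continuous_cvg _ (@continuous_cos R _) (hv _)).
apply: cvgM; first exact: (continuous_cvg _ (@continuous_expR R _) (hv _)).
exact: (continuous_cvg _ (@continuous_sin R _) (hv _)).
Qed.

Lemma powR_cvg (h : R) (u : nat -> R) (t : R) : 0 < h -> u @ \oo --> t ->
  (fun k => h `^ u k) @ \oo --> h `^ t.
Proof.
move=> h0 hu; rewrite /powR gt_eqF //.
apply: (continuous_cvg _ (@continuous_expR R _)).
by apply: cvgM => //; exact: cvg_cst.
Qed.

Lemma wsq_cvg (p : nat -> 'I_n -> R) (q : 'I_n -> R) x : (forall i, p^~ i @ \oo --> q i) ->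
  (fun k => wsq U (p k) x) @ \oo --> wsq U q x.
Proof.
move=> h; rewrite /wsq.
suff hs (r : seq 'I_n) : (fun k => \sum_(i <- r) p k i * cmod ((U *m x) i 0) ^+ 2) @ \oo
    --> \sum_(i <- r) q i * cmod ((U *m x) i 0) ^+ 2 by exact: hs.
elim: r => [|i r ih].
  by rewrite big_nil; under eq_fun do rewrite big_nil; exact: cvg_cst.
rewrite big_cons; under eq_fun do rewrite big_cons.
by apply: cvgD => //; apply: cvgM => //; exact: cvg_cst.
Qed.

Lemma dominates_power_diag (d : 'I_n -> C) (h : 'I_n -> R) (t : R) :
  (forall i, `|cIm (d i)| < pi) -> (forall i, 0 < h i) ->
  (forall x, sqnorm (U *m x) = sqnorm x) ->
  dominates U (dmx V W (fun i => cexp (d i))) h ->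
  0 <= t <= 1 ->
  dominates U (dmx V W (fun i => cexp (t%:C * d i))) (fun i => h i `^ t).
Proof.
move=> hd h0 hU hA ht.
pose P t := dominates U (dmx V W (fun i => cexp (t%:C * d i))) (fun i => h i `^ t).
have P0 : P 0.
  rewrite /P; have -> : dmx V W (fun i => cexp (0%:C * d i)) = 1%:M.
    rewrite -(dmx1 VW); apply: eq_dmx => i.
    by rewrite mul0r; apply: complex_eq; rewrite /= expR0 ?cos0 ?sin0 ?mulr1 ?mulr0.
  move=> x; rewrite reform1 -hU; apply: ler_sum => i _.
  by rewrite powRr0 mul1r.
have P1 : P 1.
  rewrite /P; have -> : (fun i => h i `^ 1) = h.
    by apply/funext => i; rewrite powRr1 // ltW.
  by apply: dominates_dmx hA => i; rewrite mul1r.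
have Pm a b : 0 <= a <= 1 -> 0 <= b <= 1 -> P a -> P b -> P ((a + b) / 2).
  move=> /andP[a0 a1] /andP[b0 b1] Pa Pb.
  (* With g = exp((a+b)d/2), this gives g e = exp(a d) and g / e = exp(b d). As |a - b|/2 <= 1/2 and
     |Im d| < pi, the argument of e is below pi/2 and Re e > 0. *)
  pose e i := cexp (((a - b) / 2)%:C * d i).
  apply: (@dominates_geometric_mean _ _ V W U VW _ e (fun i => h i `^ a) (fun i => h i `^ b)).
  - move=> i; rewrite /e /= mulr_gt0 ?expR_gt0 //; apply: cos_gt0_pihalf.
    rewrite -ltr_norml cImM /= mul0r addr0 normrM.
    have hab : `|(a - b) / 2| <= 2^-1 by rewrite ler_norml; apply/andP; split; lra.
    rewrite (le_lt_trans (y := 2^-1 * `|cIm (d i)|)) //.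
      by rewrite ler_wpM2r.
    by rewrite mulrC ltr_pM2r ?invr_gt0.
  - by move=> i; exact: powR_gt0.
  - by move=> i; exact: powR_gt0.
  - move=> i; rewrite -!powRD ?(gt_eqF (h0 i)) ?implybT // -powR_mulrn ?powR_ge0 //.
    by rewrite -powRrM divfK.
  - apply: dominates_dmx Pa => i; rewrite /e -cexpD -mulrDl -rmorphD /=.
    by rewrite (_ : (a + b) / 2 + (a - b) / 2 = a) //; lra.
  - apply: dominates_dmx Pb => i; rewrite /e.
    apply: (mulIf (cexp_neq0 (((a - b) / 2)%:C * d i))); rewrite divfK ?cexp_neq0 //.
    rewrite -cexpD -mulrDl -rmorphD /=.
    by rewrite (_ : b + (a - b) / 2 = (a + b) / 2) //; lra.
have [u hu ut] := midpoint_closed_cvg P0 P1 Pm ht.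
move=> x.
have l1 : (fun k => wsq U (fun i => h i `^ u k) x) @ \oo --> wsq U (fun i => h i `^ t) x.
  by apply: wsq_cvg => i; exact: powR_cvg.
have l2 : (fun k => reform (dmx V W (fun i => cexp ((u k)%:C * d i))) x) @ \oo
    --> reform (dmx V W (fun i => cexp (t%:C * d i))) x.
  by apply: reform_dmx_cvg => i; exact: cexp_cvg.
apply: (ler_cvg_to l1 l2); near=> k; exact: hu.
Unshelve. all: by end_near. Qed.

End PowersDiagonalizable.

(** * The power inequality without diagonalizability *)

Section Powers.
Variables (R : realType) (n : nat).
Local Notation C := R[i].
Implicit Types X : 'M[C]_n.

Lemma mexp_continuous X (eps : R) : 0 < eps -> exists2 delta, 0 < delta &
  forall Y, nrm1 (Y - X) < delta -> nrm1 (mexp Y - mexp X) <= eps.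
Proof.
move=> eps0; pose c := nrm1 X + 1.
pose K := \sum_(i < n) \sum_(j < n) (nrm1 (1%:M : 'M[C]_n) * expR (2 * c)).
have K0 : 0 <= K.
  by do 2 (apply: sumr_ge0 => ? _); rewrite mulr_ge0 ?nrm1_ge0 ?expR_ge0.
have K1 : 0 < K + 1 by rewrite ltr_wpDl.
(* The bound 1 keeps Y in the ball of radius c, where one Lipschitz constant serves; the added 1 in
   K + 1 avoids a zero denominator. *)
exists (Num.min 1 (eps / (K + 1))); first by rewrite lt_min ltr01 divr_gt0.
move=> Y; rewrite lt_min => /andP[h1 h2].
have hY : nrm1 Y <= c.
  by rewrite -[Y](subrK X) (le_trans (nrm1D _ _)) // /c addrC lerD2l ltW.
have hX : nrm1 X <= c by rewrite lerDl.
have c1 : 1 <= c by rewrite lerDr nrm1_ge0.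
apply: (@le_trans _ _ (nrm1 (Y - X) * K)).
  rewrite /K mulr_sumr; apply: ler_sum => i _; rewrite mulr_sumr; apply: ler_sum => j _.
  by rewrite mulrCA mulrA mexp_lipschitz.
apply: (@le_trans _ _ (nrm1 (Y - X) * (K + 1))).
  by rewrite ler_wpM2l ?nrm1_ge0 // lerDl.
by rewrite -ler_pdivlMr // ltW.
Qed.

Lemma finite_pos_lower_bound (h : 'I_n -> R) : (forall i, 0 < h i) ->
  exists2 mu, 0 < mu & forall i, mu <= h i.
Proof.
move=> h0; exists (\big[Num.min/1]_i h i).
  by elim/big_ind: _ => // a b a0 b0; rewrite lt_min a0.
by move=> i; rewrite (bigD1 i) //= ge_min lexx.
Qed.

(** Replace X by a diagonalizable Y so close that exp Y still dominates (1 - e) h and exp(tY) is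
    within e of exp(tX). The diagonalizable case then gives the claim up to an error proportional to
    e. *)
Lemma dominates_power (U X : 'M[C]_n) (h : 'I_n -> R) (t : R) :
  (forall l, eigenvalue X l -> `|cIm l| < pi) -> (forall i, 0 < h i) ->
  (forall x, sqnorm (U *m x) = sqnorm x) ->
  dominates U (mexp X) h -> 0 <= t <= 1 ->
  dominates U (mexp (t%:C *: X)) (fun i => h i `^ t).
Proof.
move=> hX h0 hU hA /andP[t0 t1] x.
have [mu mu0 hmu] := finite_pos_lower_bound h0.
set S := wsq _ _ _; set F := reform _ _.
have S0 : 0 <= S.
  by apply: sumr_ge0 => i _; rewrite mulr_ge0 ?powR_ge0 ?sqr_ge0.
suff key e : 0 < e -> e < 1 -> S - e * (S + sqnorm x) <= F.
  rewrite leNgt; apply/negP => FS.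
  pose k := S + sqnorm x + 1.
  have k0 : 0 < k by rewrite ltr_wpDl // addr_ge0 ?sqnorm_ge0.
  pose e := Num.min (2^-1) ((S - F) / (2 * k)).
  have e0 : 0 < e by rewrite lt_min invr_gt0 ltr0n /= divr_gt0 ?subr_gt0 // mulr_gt0.
  have e1 : e < 1 by rewrite gt_min invf_lt1 // ltr1n.
  have := key e e0 e1.
  have he : e * k <= (S - F) / 2.
    rewrite -ler_pdivlMr // -mulrA -invfM ge_min lexx orbT //.
  have : e * (S + sqnorm x) <= e * k by rewrite ler_wpM2l ?ltW // /k ltrDl.
  by lra.
move=> e0 e1.
(* The tolerance e mu turns an additive error into a relative one: e mu |y|^2 is at most e times the
   weighted form, because mu <= h. *)
have [d1 d10 hd1] := mexp_continuous X (mulr_gt0 e0 mu0).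
have [d2 d20 hd2] := mexp_continuous (t%:C *: X) e0.
have [V [W [d [VW dI hdX]]]] : exists (V W : 'M[C]_n) (d : 'rV[C]_n), [/\ V *m W = 1%:M,
    forall i, `|cIm (d 0 i)| < pi & nrm1 (V *m diag_mx d *m W - X) < Num.min d1 d2].
  by apply: approx_diag; rewrite // lt_min d10.
move: hdX; rewrite lt_min => /andP[hX1 hX2].
pose f i := d 0 i.
have E : V *m diag_mx d *m W = dmx V W f.
  by rewrite /dmx; congr (_ *m diag_mx _ *m _); apply/rowP => i; rewrite mxE.
rewrite E in hX1 hX2.
have hU1 y : wsq U (fun=> 1) y = sqnorm y.
  by rewrite -hU; apply: eq_bigr => i _; rewrite mul1r.
have close (A B : 'M[C]_n) y c : nrm1 (A - B) <= c ->
    reform B y - c * sqnorm y <= reform A y <= reform B y + c * sqnorm y.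
  move=> hc; have -> : reform A y = reform (A - B) y + reform B y.
    by rewrite -reformD subrK.
  have := reform_bound (A - B) y; rewrite ler_norml => /andP[h1 h2].
  have : nrm1 (A - B) * sqnorm y <= c * sqnorm y by rewrite ler_wpM2r ?sqnorm_ge0.
  by move=> h3; apply/andP; split; lra.
have dom1 : dominates U (dmx V W (fun i => cexp (f i))) (fun i => (1 - e) * h i).
  move=> y; rewrite -mexp_dmx //; have /andP[hc _] := close _ _ y _ (hd1 _ hX1); apply: le_trans hc.
  have -> : wsq U (fun i => (1 - e) * h i) y = wsq U h y - e * wsq U h y.
    by rewrite /wsq mulr_sumr -sumrB; apply: eq_bigr => i _; ring.
  have := hA y; have : mu * sqnorm y <= wsq U h y.
    rewrite -hU1 /wsq mulr_sumr; apply: ler_sum => i _.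
    by rewrite mul1r ler_wpM2r ?sqr_ge0.
  by move=> h1 h2; have := ler_wpM2l (ltW e0) h1; lra.
have e10 : 0 < 1 - e by rewrite subr_gt0.
have h'0 i : 0 < (1 - e) * h i by rewrite mulr_gt0.
have t01 : 0 <= t <= 1 by rewrite t0 t1.
have hdiag := dominates_power_diag VW dI h'0 hU dom1 t01 x.
have hX3 : nrm1 (t%:C *: dmx V W f - t%:C *: X) < d2.
  rewrite -scalerBr nrm1Z cmodR ger0_norm // (le_lt_trans _ hX2) //.
  by rewrite ler_piMl ?nrm1_ge0.
have hF : reform (dmx V W (fun i => cexp (t%:C * f i))) x <= F + e * sqnorm x.
  have /andP[_] := close _ _ x _ (hd2 _ hX3).
  by rewrite dmxZ mexp_dmx.
(* Here t <= 1 enters: (1 - e)^t >= 1 - e. *)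
have hS : (1 - e) * S <= wsq U (fun i => ((1 - e) * h i) `^ t) x.
  rewrite /S /wsq mulr_sumr; apply: ler_sum => i _; rewrite mulrA ler_wpM2r ?sqr_ge0 //.
  rewrite powRM; [|exact: ltW|exact: ltW].
  rewrite ler_wpM2r ?powR_ge0 //.
  by apply: ger1_powR => //; rewrite e10 gerBl ltW.
have hfin := le_trans hS (le_trans hdiag hF).
rewrite mulrBl mul1r lerBlDr -addrA [e * _ + _]addrC -mulrDr -lerBlDr in hfin.
exact: hfin.
Qed.

End Powers.

(** * The q-numerical radius *)

Section InnerProduct.
Variable R : realType.
Local Notation C := R[i].

(* Inside [\sum] and as an argument of [*], [z^*] parses as [Num.conj z] instead of [conjc z]. *)
Lemma numconjE (z : C) : (z^*)%R = conjc z.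
Proof. by []. Qed.

Lemma sqnormZ n a (x : 'cV[C]_n) : sqnorm (a *: x) = cmod a ^+ 2 * sqnorm x.
Proof.
by rewrite /sqnorm mulr_sumr; apply: eq_bigr => i _; rewrite mxE cmodM exprMn.
Qed.

Lemma sqnorm_eq0 n (x : 'cV[C]_n) : (sqnorm x == 0) = (x == 0).
Proof.
rewrite /sqnorm psumr_eq0; last by move=> i _; exact: sqr_ge0.
apply/allP/eqP => [h|-> i _]; last by rewrite mxE cmod0 expr0n /= eqxx.
apply/matrixP => i j; rewrite ord1 mxE; apply/eqP.
by have := h i (mem_index_enum _); rewrite /= sqrf_eq0 cmod_eq0.
Qed.

Lemma sqnorm_gt0 n (x : 'cV[C]_n) : x != 0 -> 0 < sqnorm x.
Proof. by rewrite -sqnorm_eq0 lt_neqAle sqnorm_ge0 eq_sym => ->. Qed.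

Lemma unitvE n (x : 'cV[C]_n) : unitv x <-> sqnorm x = 1.
Proof. by rewrite /unitv cdotxx; split=> [[]//|->]. Qed.

Lemma normalize n (x : 'cV[C]_n) : x != 0 ->
  exists2 c : R, 0 < c & unitv (c%:C *: x).
Proof.
move=> /sqnorm_gt0 x0; exists (Num.sqrt (sqnorm x))^-1.
  by rewrite invr_gt0 sqrtr_gt0.
apply/unitvE; rewrite sqnormZ cmodR ger0_norm ?invr_ge0 ?sqrtr_ge0 //.
by rewrite exprVn sqr_sqrtr ?ltW // mulVf ?gt_eqF.
Qed.

(** Coordinatewise, the defect is c^-1 (c a - b)^2; with a free weight c this replaces
    Cauchy-Schwarz and avoids square roots. *)
Lemma cdot_young n (x y : 'cV[C]_n) (c : R) : 0 < c ->
  2 * cmod (cdot x y) <= c * sqnorm x + c^-1 * sqnorm y.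
Proof.
move=> c0; rewrite /cdot.
apply: (@le_trans _ _ (2 * \sum_i cmod (x i 0) * cmod (y i 0))).
  rewrite ler_wpM2l // (le_trans (cmod_sum _ _ _)) //.
  by apply: ler_sum => i _; rewrite cmodM cmodJ.
rewrite /sqnorm !mulr_sumr -big_split; apply: ler_sum => i _ /=.
move: (cmod (x i 0)) (cmod (y i 0)) => a b.
have -> : c * a ^+ 2 + c^-1 * b ^+ 2 = 2 * (a * b) + c^-1 * (c * a - b) ^+ 2.
  by field; rewrite gt_eqF.
by rewrite lerDl mulr_ge0 ?sqr_ge0 ?invr_ge0 ?ltW.
Qed.

Lemma cdot_unit_bound n (A : 'M[C]_n) x y : unitv x -> unitv y ->
  cmod (cdot (A *m x) y) <= nrm1 A.
Proof.
move=> /unitvE hx /unitvE hy.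
have le1 (z : 'cV[C]_n) k : sqnorm z = 1 -> cmod (z k 0) <= 1.
  move=> hz; rewrite -(@expr_le1 _ 2) ?cmod_ge0 // -hz /sqnorm (bigD1 k) //= lerDl.
  by apply: sumr_ge0 => l _; exact: sqr_ge0.
rewrite /cdot (le_trans (cmod_sum _ _ _)) // /nrm1; apply: ler_sum => i _.
rewrite cmodM cmodJ -[leRHS]mulr1 ler_pM ?cmod_ge0 ?le1 //.
rewrite mxE (le_trans (cmod_sum _ _ _)) //; apply: ler_sum => j _.
by rewrite cmodM ler_piMr ?cmod_ge0 ?le1.
Qed.

Lemma exists_orthogonal n (x : 'cV[C]_n) : (1 < n)%N ->
  exists2 z : 'cV[C]_n, unitv z & cdot x z = 0.
Proof.
case: n x => [|[|n]] // x _.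
suff [z z0 xz] : exists2 z : 'cV[C]_n.+2, z != 0 & cdot x z = 0.
  have [c _ hc] := normalize z0; exists (c%:C *: z) => //.
  by rewrite cdotZr xz mulr0.
pose i0 : 'I_n.+2 := ord0; pose i1 : 'I_n.+2 := lift ord0 ord0.
(* Orthogonal to x within the first two coordinates, and nonzero once the first coordinate of x is;
   otherwise the first basis vector serves. *)
pose f (i : 'I_n.+2) : C := if i == i0 then (x i1 0)^* else
                            if i == i1 then - (x i0 0)^* else 0.
pose z : 'cV[C]_n.+2 := \col_i f i.
have [x0|x0] := eqVneq (x i0 0) 0.
  exists (delta_mx i0 0).
    by apply/eqP => /matrixP/(_ i0 0)/eqP; rewrite !mxE !eqxx oner_eq0.
  rewrite /cdot (bigD1 i0) //= x0 mul0r add0r big1 // => i ii0.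
  by rewrite mxE (negPf ii0) rmorph0 mulr0.
exists z.
  apply/eqP => /matrixP/(_ i1 0)/eqP; rewrite !mxE /= oppr_eq0 conjc_eq0.
  by rewrite (negPf x0).
have zi0 : z i0 0 = (x i1 0)^* by rewrite mxE /f eqxx.
have zi1 : z i1 0 = - (x i0 0)^* by rewrite mxE.
rewrite /cdot (bigD1 i0) // (bigD1 i1) //= zi0 zi1 !numconjE conjcK rmorphN /= conjcK.
rewrite big1 ?addr0 => [|i /andP[/negPf h0 /negPf h1]].
  by rewrite mulrN [X in _ - X]mulrC subrr.
by rewrite mxE /f h0 h1 rmorph0 mulr0.
Qed.

End InnerProduct.

Section QNumericalRadius.
Variables (R : realType) (n : nat) (q : R[i]).
Hypothesis hn : (1 < n)%N \/ ((0 < n)%N /\ cmod q = 1).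
Hypothesis hq : cmod q <= 1.
Local Notation C := R[i].

Definition wqset (A : 'M[C]_n) : set R := [set r : R | exists x y : 'cV[C]_n,
  [/\ unitv x, unitv y, cdot x y = q & r = cmod (cdot (A *m x) y)]].

Lemma wqset_ubound (A : 'M[C]_n) : has_ubound (wqset A).
Proof. by exists (nrm1 A) => r [x [y [hx hy _ ->]]]; exact: cdot_unit_bound. Qed.

Lemma exists_unitv : exists x : 'cV[C]_n, unitv x.
Proof.
have n0 : (0 < n)%N by case: hn => [|[]//]; exact: ltnW.
exists (delta_mx (Ordinal n0) 0); apply/unitvE.
rewrite /sqnorm (bigD1 (Ordinal n0)) //= big1 => [|i hi].
  by rewrite mxE !eqxx cmod1 expr1n addr0.
by rewrite mxE (negPf hi) cmod0 expr0n.
Qed.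

(** Take y = conj(q) x +- s z with z orthogonal to x and s^2 = 1 - |q|^2. The two values <Ax,y> =
    q<Ax,x> +- s<Ax,z> have sum 2q<Ax,x>, so one of them has modulus at least |q<Ax,x>|. *)
Lemma exists_qpair (A : 'M[C]_n) x : unitv x -> exists2 y, unitv y /\ cdot x y = q &
  cmod q * cmod (cdot (A *m x) x) <= cmod (cdot (A *m x) y).
Proof.
move=> hx.
(* The normalisation of z is weighted by 1 - |q|^2 so that z = 0 is allowed when |q| = 1; this
   covers dimension 1, which has no unit vector orthogonal to x. *)
have [z xz hz] : exists2 z : 'cV[C]_n, cdot x z = 0 &
    (1 - cmod q ^+ 2) * sqnorm z = 1 - cmod q ^+ 2.
  case: hn => [n1|[_ ->]].
    have [z zu xz] := exists_orthogonal x n1; exists z => //.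
    by move/unitvE: zu => ->; rewrite mulr1.
  exists 0; last by rewrite expr1n subrr mul0r.
  by rewrite /cdot big1 // => i _; rewrite mxE rmorph0 mulr0.
pose s := Num.sqrt (1 - cmod q ^+ 2).
have s2 : s ^+ 2 = 1 - cmod q ^+ 2.
  by rewrite sqr_sqrtr // subr_ge0 expr_le1 ?cmod_ge0.
have zx : cdot z x = 0 by rewrite cdotC xz rmorph0.
pose Y (e : R) := conjc q *: x + (e * s)%:C *: z.
have xY e : cdot x (Y e) = q.
  by rewrite cdotDr !cdotZr xz mulr0 addr0 conjcK hx mulr1.
have YY e : e ^+ 2 = 1 -> unitv (Y e).
  move=> e2; rewrite /unitv /Y cdotDl !cdotDr !cdotZl !cdotZr xz zx !mulr0 addr0 add0r.
  rewrite hx cdotxx conjcK conjc_real mulr1 [conjc q * q]mulrC (mulJ_Re q).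
  rewrite -!rmorphM -rmorphD /=; congr (_%:C).
  have -> : e * s * (e * s * sqnorm z) = e ^+ 2 * (s ^+ 2 * sqnorm z) by ring.
  by rewrite e2 mul1r s2 hz addrC subrK.
have hY e : cdot (A *m x) (Y e) = q * cdot (A *m x) x + (e * s)%:C * cdot (A *m x) z.
  by rewrite cdotDr !cdotZr conjcK conjc_real.
pose a := q * cdot (A *m x) x; pose b := s%:C * cdot (A *m x) z.
have hab : 2 * cmod a <= cmod (a + b) + cmod (a - b).
  have := cmodD (a + b) (a - b).
  have -> : a + b + (a - b) = (2 : R)%:C * a by rewrite -natr_realC; ring.
  by rewrite cmodM cmodR ger0_norm.
have [h|h] := leP (cmod a) (cmod (a + b)).
  exists (Y 1); first by split; [apply: YY; rewrite expr1n | exact: xY].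
  by rewrite -cmodM hY mul1r.
exists (Y (-1)); first by split; [apply: YY; rewrite sqrrN expr1n | exact: xY].
rewrite -cmodM hY mulN1r rmorphN /= mulNr -/a -/b; lra.
Qed.

Lemma wq_ge (A : 'M[C]_n) x : unitv x -> cmod q * cmod (cdot (A *m x) x) <= wq q A.
Proof.
move=> hx; have [y [hy xy] h] := exists_qpair A hx.
apply: (le_trans h); apply: (ub_le_sup (wqset_ubound A)).
by exists x, y.
Qed.

Lemma wq_le (A : 'M[C]_n) M : (forall x y, unitv x -> unitv y -> cmod (cdot (A *m x) y) <= M) ->
  wq q A <= M.
Proof.
move=> h; apply: ge_sup => [|r [x [y [hx hy _ ->]]]]; last exact: h.
have [x hx] := exists_unitv; have [y [hy xy] _] := exists_qpair A hx.
by exists (cmod (cdot (A *m x) y)), x, y.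
Qed.

End QNumericalRadius.

(** * Spectral theorem for the Hermitian part *)

Section Spectral.
Variable R : realType.
Local Notation C := R[i].

Definition adjmx n (A : 'M[C]_n) : 'M[C]_n := (map_mx conjc A)^T.

Lemma cdot_adj n (A : 'M[C]_n) x y : cdot (A *m x) y = cdot x (adjmx A *m y).
Proof.
rewrite /cdot; under eq_bigr do rewrite mxE mulr_suml.
rewrite exchange_big; apply: eq_bigr => i _.
rewrite mxE rmorph_sum mulr_sumr; apply: eq_bigr => j _.
by rewrite !mxE rmorphM /= !numconjE conjcK; ring.
Qed.

Lemma adjmxK n (A : 'M[C]_n) : adjmx (adjmx A) = A.
Proof. by apply/matrixP => i j; rewrite !mxE conjcK. Qed.

Lemma reform_adj n (A : 'M[C]_n) x : reform (adjmx A) x = reform A x.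
Proof. by rewrite /reform cdotC -cdot_adj cReJ. Qed.

(** In the last clause the eigenvector is chosen before the weights [p], so one vector tests both h
    and its powers h^t. *)
Lemma hermitian_part_diagonalization n (A : 'M[C]_n) :
  exists (U : 'M[C]_n) (h : 'I_n -> R),
  [/\ forall x, sqnorm (U *m x) = sqnorm x, forall x, reform A x = wsq U h x &
      forall i, exists2 x, unitv x & forall p, wsq U p x = p i].
Proof.
pose H := A + adjmx A.
have Hn : H \is normalmx.
  apply: hermitian_normalmx; apply/is_hermitianmxP; rewrite expr0 scale1r.
  apply/matrixP => i j; rewrite !mxE [RHS](rmorphD conjc) /= conjcK addrC.
  by [].
have HE := orthomx_spectralP Hn.
set P := spectralmx H in HE; set d := spectral_diag H in HE.
have Pu : P \is unitarymx by exact: spectral_unitarymx.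
have PV : invmx P = adjmx P.
  by rewrite invmx_unitary //; apply/matrixP => i j; rewrite !mxE.
have Pun : P \in unitmx by exact: unitarymx_unit.
have iso x : sqnorm (P *m x) = sqnorm x.
  by apply: complexI; rewrite -!cdotxx cdot_adj mulmxA -PV mulVmx // mul1mx.
exists P, (fun i => cRe (d 0 i) / 2); split => //.
- move=> x; have -> : reform A x = reform H x / 2.
    by rewrite /H reformD reform_adj; lra.
  rewrite /reform HE PV -!mulmxA cdot_adj adjmxK /cdot cRe_sum mulr_suml.
  apply: eq_bigr => i _; rewrite mul_diag_mx mxE -mulrA.
  by rewrite (mulJ_Re ((P *m x) i 0)) cReM /= mulr0 subr0; ring.
- move=> i; pose x := adjmx P *m (delta_mx i 0 : 'cV[C]_n).
  have Px : P *m x = delta_mx i 0 by rewrite /x mulmxA -PV mulmxV // mul1mx.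
  exists x.
    apply/unitvE; rewrite -iso Px /sqnorm (bigD1 i) //= mxE !eqxx cmod1 expr1n.
    by rewrite big1 ?addr0 // => j /negPf ji; rewrite mxE ji cmod0 expr0n.
  move=> p; rewrite /wsq Px (bigD1 i) //= mxE !eqxx cmod1 expr1n mulr1.
  by rewrite big1 ?addr0 // => j /negPf ji; rewrite mxE ji cmod0 expr0n mulr0.
Qed.

End Spectral.

(** * Sectorial matrices *)

Section Sector.
Variables (R : realType) (n : nat) (alpha : R) (A : 'M[R[i]]_n).
Hypothesis halpha : 0 <= alpha < pi / 2.
Hypothesis hA : PiSector alpha A.
Local Notation C := R[i].

Lemma cos_alpha_gt0 : 0 < cos alpha.
Proof.
have /andP[a0 a1] := halpha; apply: cos_gt0_pihalf; rewrite a1 andbT.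
by rewrite (lt_le_trans _ a0) // oppr_lt0 divr_gt0 ?pi_gt0.
Qed.

Lemma sin_alpha_ge0 : 0 <= sin alpha.
Proof.
have /andP[a0 a1] := halpha; have [->|a2] := eqVneq alpha 0; first by rewrite sin0.
by apply/ltW/sin_gt0_pihalf; rewrite lt_neqAle eq_sym a2 a0.
Qed.

Lemma cdot_scaled (x : 'cV[C]_n) (c : R) :
  cdot (A *m (c%:C *: x)) (c%:C *: x) = (c ^+ 2)%:C * cdot (A *m x) x.
Proof. by rewrite -scalemxAr cdotZl cdotZr conjc_real mulrA -rmorphM /= -expr2. Qed.

Lemma sector_reform_gt0 x : x != 0 -> 0 < reform A x.
Proof.
move=> /normalize[c c0 hc]; have [] := hA hc.
by rewrite cdot_scaled cReM /= mul0r subr0 pmulr_rgt0 // exprn_gt0.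
Qed.

(** The closed sector is the intersection of two half-planes, one for each sign e; in this linear
    form the condition extends to all vectors, including 0. *)
Lemma sector_cone (e : R) (x : 'cV[C]_n) : `|e| = 1 ->
  0 <= sin alpha * cRe (cdot (A *m x) x) + e * cos alpha * cIm (cdot (A *m x) x).
Proof.
move=> he; rewrite -lerBlDr sub0r.
apply: (@le_trans _ _ (cos alpha * `|cIm (cdot (A *m x) x)|)).
  rewrite (le_trans (ler_norm _)) // normrN !normrM he mul1r.
  by rewrite ger0_norm ?(ltW cos_alpha_gt0).
have [->|x0] := eqVneq x 0.
  by rewrite /reform mulmx0 /cdot big1 ?normr0 ?mulr0 // => i _; rewrite mxE mul0r.
have [c c0 hc] := normalize x0; have [_] := hA hc.
rewrite cdot_scaled cImM cReM /= !mul0r subr0 addr0 normrM (ger0_norm (sqr_ge0 _)).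
rewrite mulrCA ler_pM2l ?exprn_gt0 // /tan mulrAC ler_pdivlMr ?cos_alpha_gt0 //.
by rewrite mulrC.
Qed.

Lemma cdot_sub_scaled (z : C) (v w : 'cV[C]_n) :
  cdot (A *m (v - z *: w)) (v - z *: w) = cdot (A *m v) v - conjc z * cdot (A *m v) w
    - z * cdot (A *m w) v + (z * conjc z) * cdot (A *m w) w.
Proof.
rewrite -[- (z *: w)]scaleNr mulmxDr -scalemxAr !cdotDl !cdotDr !cdotZl !cdotZr.
by rewrite rmorphN /=; ring.
Qed.

(* For [N+-(u) = sin(alpha) Re<Au,u> +- cos(alpha) Im<Au,u> >= 0] and [z = e^(-i alpha)], expand
   [N+(v - z w) + N-(v - conj(z) w) >= 0]; the terms in [<Aw,v>] cancel. *)
Lemma sector_cauchy_schwarz (v w : 'cV[C]_n) :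
  2 * cos alpha * cRe (cdot (A *m v) w) <= reform A v + reform A w.
Proof.
have s0 := sin_alpha_ge0; have c0 := cos_alpha_gt0.
have cs := cos2Dsin2 alpha.
(* The general argument ends by dividing by 2 sin(alpha). If sin(alpha) = 0 the form is real, which
   at v - i w gives Re <Av,w> = Re <Aw,v>, and positivity at v - w concludes. *)
have [s00|s1] := eqVneq (sin alpha) 0.
  have c1 : cos alpha = 1.
    apply/eqP; rewrite -(@eqrXn2 _ 2) ?ltW // expr1n; apply/eqP.
    by rewrite -cs s00 expr0n addr0.
  have im0 u : cIm (cdot (A *m u) u) = 0.
    have := @sector_cone 1 u (normr1 _); have := @sector_cone (-1) u (normrN1 _).
    by rewrite s00 c1; move: (cRe _) (cIm _) => a b; lra.
  have re0 u : 0 <= cRe (cdot (A *m u) u).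
    have [->|u0] := eqVneq u 0; last exact/ltW/sector_reform_gt0.
    by rewrite mulmx0 /cdot big1 // => i _; rewrite mxE mul0r.
  have h1 := re0 (v - 1 *: w).
  have h2 := im0 (v - 'i *: w).
  have h3 := im0 v; have h4 := im0 w.
  rewrite cdot_sub_scaled in h1; rewrite cdot_sub_scaled in h2.
  rewrite c1 /reform; move: h1 h2 h3 h4.
  move: (cdot (A *m v) v) (cdot (A *m v) w) (cdot (A *m w) v) (cdot (A *m w) w).
  by case=> a a' [b b'] [d d'] [e e'] /=; lra.
have {s0 s1} s0 : 0 < sin alpha by rewrite lt_neqAle eq_sym s1.
pose z : C := Complex (cos alpha) (- sin alpha).
have h1 := @sector_cone 1 (v - z *: w) (normr1 _).
have h2 := @sector_cone (-1) (v - conjc z *: w) (normrN1 _).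
rewrite cdot_sub_scaled in h1; rewrite cdot_sub_scaled conjcK in h2.
rewrite /reform; move: h1 h2.
move: (cdot (A *m v) v) (cdot (A *m v) w) (cdot (A *m w) v) (cdot (A *m w) w).
case=> a a' [b b'] [d d'] [e e'] /= h1 h2.
have key : 0 <= 2 * sin alpha * (a + (cos alpha ^+ 2 + sin alpha ^+ 2) * e)
                - 2 * sin alpha * (2 * cos alpha * b).
  by have := addr_ge0 h1 h2; congr (0 <= _); ring.
by rewrite cs mul1r subr_ge0 ler_pM2l ?mulr_gt0 in key.
Qed.

(** Multiply x by a phase making <Ax,y> real and nonnegative; [sector_cauchy_schwarz] then bounds 2
    cos(alpha) |<Ax,y>| by 2r. *)
Lemma sector_cdot_le r x y : unitv x -> unitv y -> (forall u, reform A u <= r * sqnorm u) ->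
  cmod (cdot (A *m x) y) <= r / cos alpha.
Proof.
move=> /unitvE hx /unitvE hy hr; set z := cdot _ _.
have c0 := cos_alpha_gt0.
have [z0|z0] := eqVneq z 0.
  rewrite z0 cmod0 divr_ge0 ?(ltW c0) //.
  have x0 : x != 0 by rewrite -sqnorm_eq0 hx oner_eq0.
  by have := hr x; rewrite hx mulr1; apply: le_trans; exact/ltW/sector_reform_gt0.
pose m := cmod z; have m0 : 0 < m by rewrite lt_neqAle cmod_ge0 eq_sym cmod_eq0 z0.
pose u := (conjc z / m%:C) *: x.
have hu : sqnorm u = 1.
  rewrite sqnormZ hx mulr1 cmodM cmodJ cmodV cmodR gtr0_norm // -/m.
  by rewrite divff ?expr1n ?gt_eqF.
have := sector_cauchy_schwarz u y.
have -> : cdot (A *m u) y = m%:C.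
  rewrite /u -scalemxAr cdotZl -/z mulrAC [conjc z * z]mulrC (mulJ_Re z) -/m.
  by rewrite expr2 rmorphM /= mulfK // (inj_eq (@complexI R)) gt_eqF.
have := hr u; have := hr y; rewrite hu hy !mulr1 /= => h1 h2 h3.
by rewrite -/m ler_pdivlMr // ; lra.
Qed.

(** With v = Ax this reads Re <A^-1 v, v> >= (cos^2(alpha)/r) |v|^2. It is [sector_cauchy_schwarz]
    for x and c Ax, where c = cos(alpha)/r maximises 2 c cos(alpha) - c^2 r. *)
Lemma sector_inverse_bound r x : 0 < r -> (forall u, reform A u <= r * sqnorm u) ->
  cos alpha ^+ 2 / r * sqnorm (A *m x) <= reform A x.
Proof.
move=> r0 hr; have := sector_cauchy_schwarz x ((cos alpha / r)%:C *: (A *m x)).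
rewrite cdotZr conjc_real cdotxx -rmorphM /=.
have -> : reform A ((cos alpha / r)%:C *: (A *m x)) = (cos alpha / r) ^+ 2 * reform A (A *m x).
  by rewrite /reform cdot_scaled cReM /= mul0r subr0.
have := ler_wpM2l (sqr_ge0 (cos alpha / r)) (hr (A *m x)).
have -> : (cos alpha / r) ^+ 2 * (r * sqnorm (A *m x)) = cos alpha ^+ 2 / r * sqnorm (A *m x).
  by field; rewrite gt_eqF.
have -> : 2 * cos alpha * (cos alpha / r * sqnorm (A *m x)) = 2 * (cos alpha ^+ 2 / r * sqnorm (A *m x)).
  by field; rewrite gt_eqF.
lra.
Qed.

Lemma sector_eigenvalue l : eigenvalue A l -> 0 < cRe l.
Proof.
move=> /eigenvalueP[v hv v0].
(* [eigenvalue] refers to row vectors, v A = l v; for the conjugate transpose x of v this gives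
   <Ax,x> = l <x,x>. *)
pose x : 'cV[C]_n := (map_mx conjc v)^T.
have x0 : x != 0.
  apply: contra v0 => /eqP/matrixP h; apply/eqP/matrixP => i j; rewrite ord1 mxE.
  by have /eqP := h j 0; rewrite !mxE conjc_eq0 => /eqP.
have -> : cRe l = reform A x / sqnorm x.
  have -> : reform A x = cRe l * sqnorm x.
    rewrite /reform; suff -> : cdot (A *m x) x = l * cdot x x.
      by rewrite cdotxx cReM /= mulr0 subr0.
    have hj j : \sum_i v 0 i * A i j = l * v 0 j.
      by move/matrixP: hv => /(_ 0 j); rewrite !mxE.
    rewrite /cdot mulr_sumr; under eq_bigr do rewrite mxE mulr_suml.
    rewrite exchange_big; apply: eq_bigr => j _ /=.
    under eq_bigr => i _ do rewrite [X in _ * X^*%R]mxE [X in _ * X^*%R]mxE numconjE conjcK mulrAC.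
    rewrite -mulr_suml [X in _ = _ * (_ * X^*%R)]mxE [X in _ = _ * (_ * X^*%R)]mxE numconjE conjcK.
    under eq_bigr do rewrite mulrC.
    by rewrite hj mulrAC mulrA.
  by rewrite mulfK // gt_eqF // sqnorm_gt0.
by rewrite divr_gt0 ?sqnorm_gt0 ?sector_reform_gt0.
Qed.

End Sector.

(** * From the power inequality to the bounds on the q-numerical radius *)

Section Assembly.

Lemma wsq1 (R : realType) n (c : R) (x : 'cV[R[i]]_n) : wsq 1%:M (fun=> c) x = c * sqnorm x.
Proof. by rewrite /wsq mul1mx -mulr_sumr. Qed.

Lemma plogP (R : realType) n (A : 'M[R[i]]_n) : (forall l, eigenvalue A l -> 0 < cRe l) ->
  mexp (plog A) = A /\ forall l, eigenvalue (plog A) l -> `|cIm l| < pi.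
Proof.
move=> hA; have [X eX hX] := exists_log hA.
have [e h] : mexp (plog A) = A /\
    (forall l : R[i], eigenvalue (plog A) l -> - pi < cIm l < pi).
  rewrite /plog; set P := (X in xget _ X); suff : P (xget 0 P) by [].
  have PX : P X by split; [exact: eX | move=> l hl; rewrite -ltr_norml; exact: hX].
  exact: (xgetPex 0 (ex_intro P X PX)).
split; first exact: e.
by move=> l hl; rewrite ltr_norml; exact: h.
Qed.

Lemma eigenvalueN (F : fieldType) n (X : 'M[F]_n) l : eigenvalue (- X) l -> eigenvalue X (- l).
Proof.
move=> /eigenvalueP[v hv v0]; apply/eigenvalueP; exists v => //.
by rewrite -[X]opprK mulmxN hv scaleNr.
Qed.

Lemma reform_le_cmod (R : realType) n (A : 'M[R[i]]_n) x : reform A x <= cmod (cdot (A *m x) x).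
Proof. exact: le_trans (ler_norm _) (cRe_le_cmod _). Qed.

(** Lower bounds on a real part bound the norm of the inverse: m |Tx|^2 <= |<x,Tx>|, and Young with
    weight m^-1 gives m |Tx|^2 <= m^-1. A second use, with weight m, bounds <Tx,y>. *)
Lemma accretive_inverse_bound (R : realType) n (S T : 'M[R[i]]_n) (m : R) x y :
  0 < m -> S *m T = 1%:M -> (forall u, m * sqnorm u <= reform S u) ->
  unitv x -> unitv y -> cmod (cdot (T *m x) y) <= m^-1.
Proof.
move=> m0 ST hS /unitvE hx /unitvE hy.
have h1 : m * sqnorm (T *m x) <= cmod (cdot x (T *m x)).
  apply: le_trans (hS _) _; rewrite /reform mulmxA ST mul1mx.
  exact: le_trans (ler_norm _) (cRe_le_cmod _).
have := cdot_young x (T *m x) (c := m^-1); rewrite invr_gt0 invrK hx mulr1 => /(_ m0) h2.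
have := cdot_young (T *m x) y m0; rewrite hy mulr1 => h3.
lra.
Qed.

(** Intended values: a = |q|, Q = |q|^t, p = r^t, W = w_q(A)^t, c = cos^t(alpha), k =
    cos^(2t)(alpha), C = cos(t alpha), B = w_q(A^t), B' = w_q(A^-t). The estimates fed in are free
    of C, and [C <= 1] introduces it. *)
Lemma radius_arithmetic (R : realType) (Q c k C W p a B B' : R) :
  0 < a -> Q * p <= W -> c * W <= p -> 0 < k -> 0 < C -> C <= 1 -> 0 < W -> 0 < p -> 0 < Q ->
  a * p <= B -> B <= (k / p)^-1 -> a * (k / p) <= B' ->
  (Q * a * c * W <= Q * B /\ Q * B <= k^-1 * C^-1 * W) /\ Q * a * C * k * W^-1 <= B'.
Proof.
move=> a_gt0 Qp cW k_gt0 C_gt0 C1 W_gt0 p_gt0 Q_gt0 h1 h2 h3.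
split; [split|].
- rewrite -!mulrA ler_pM2l // (le_trans _ h1) // ler_pM2l //.
- apply: (@le_trans _ _ (Q * (p / k))); first by rewrite ler_pM2l // -invf_div.
  have -> : Q * (p / k) = k^-1 * (Q * p) by ring.
  rewrite -mulrA ler_pM2l ?invr_gt0 //.
  by rewrite (le_trans Qp) // ler_peMl ?(ltW W_gt0) // invf_ge1.
- apply: le_trans h3.
  have -> : Q * a * C * k / W = (a * k) * (C * (Q / W)) by ring.
  rewrite [a * (k / p)]mulrA ler_pM2l ?mulr_gt0 //.
  apply: (@le_trans _ _ (Q / W)); first by rewrite ler_piMl // divr_ge0 // ltW.
  by rewrite ler_pdivrMr // mulrC ler_pdivlMr.
Qed.

End Assembly.

Theorem theorem2p21 (R : realType) (n : nat) (alpha : R) (A : 'M[R[i]]_n)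
    (q : R[i]) (t : R)
    (hn : (1 < n)%N \/ ((0 < n)%N /\ cmod q = 1))
    (halpha : 0 <= alpha < pi / 2)
    (hA : PiSector alpha A)
    (hq : 0 < cmod q <= 1)
    (ht : 0 <= t <= 1) :
  (cmod q `^ (t + 1) * cos alpha `^ t * wq q A `^ t
     <= cmod q `^ t * wq q (mpow t A)
   /\ cmod q `^ t * wq q (mpow t A)
     <= (cos alpha)^-1 `^ (2 * t) * (cos (t * alpha))^-1 * wq q A `^ t)
  /\
  cmod q `^ (t + 1) * cos (t * alpha) * cos alpha `^ (2 * t) * wq q A `^ (- t)
     <= wq q (mpow (- t) A).
Proof.
have /andP[q0 q1] := hq; have /andP[t0 t1] := ht; have /andP[a0 a1] := halpha.
have c0 := cos_alpha_gt0 halpha.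
have [eX hX] := plogP (sector_eigenvalue hA); rewrite /mpow.
set X := plog A in eX hX *.
have [U [h [hU hAU hsec]]] := hermitian_part_diagonalization A.
have h0 i : 0 < h i.
  have [x xu hx] := hsec i; rewrite -(hx h) -hAU; apply: (sector_reform_gt0 hA).
  by rewrite -sqnorm_eq0 (proj1 (unitvE x) xu) oner_eq0.
have n0 : (0 < n)%N by case: hn => [|[]//]; exact: ltnW.
pose i0 : 'I_n := [arg max_(i > Ordinal n0) h i]%O.
have hmax i : h i <= h i0.
  by rewrite /i0; case: Order.TotalTheory.arg_maxP => // j _ /(_ i); apply.
pose r := h i0; have r0 : 0 < r by exact: h0.
have Ar u : reform A u <= r * sqnorm u.
  rewrite hAU -hU /sqnorm mulr_sumr; apply: ler_sum => i _.
  by rewrite ler_wpM2r ?sqr_ge0 ?hmax.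
have [x0 x0u hx0] := hsec i0.
have Ax0 : reform A x0 = r by rewrite hAU hx0.
have w_ge : cmod q * r <= wq q A.
  apply: le_trans (wq_ge hn q1 A x0u); rewrite ler_wpM2l ?(ltW q0) // -Ax0.
  exact: reform_le_cmod.
have w_le : cos alpha * wq q A <= r.
  rewrite mulrC -ler_pdivlMr //; apply: (wq_le hn q1) => x y xu yu.
  exact: (sector_cdot_le halpha hA xu yu Ar).
have w0 : 0 < wq q A by rewrite (lt_le_trans _ w_ge) // mulr_gt0.
have dA : dominates U (mexp X) h by move=> x; rewrite eX hAU.
(* At the top eigenvector of Re A the weighted form with weights h^t takes the value r^t. *)
have low : r `^ t <= reform (mexp (t%:C *: X)) x0.
  have := dominates_power hX h0 hU dA ht x0.
  by rewrite (hx0 (fun i => h i `^ t)).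
pose m := cos alpha ^+ 2 / r; have m0 : 0 < m by rewrite divr_gt0 ?exprn_gt0.
have hU1 x : sqnorm ((1%:M : 'M[R[i]]_n) *m x) = sqnorm x by rewrite mul1mx.
(* The strip is symmetric, so -X serves as the logarithm of A^-1 and [dominates_power] applies to it
   directly. *)
have hXN l : eigenvalue (- X) l -> `|cIm l| < pi.
  by move=> /eigenvalueN/hX; rewrite cImN normrN.
have dN : dominates 1%:M (mexp (- X)) (fun=> m).
  move=> u; rewrite wsq1; pose v := mexp (- X) *m u.
  have Av : A *m v = u by rewrite /v mulmxA -eX mexpNK mul1mx.
  rewrite /reform -/v -Av; have := sector_inverse_bound halpha hA v r0 Ar.
  by rewrite /reform cdotC cReJ.
have dNt u : m `^ t * sqnorm u <= reform (mexp ((- t)%:C *: X)) u.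
  have := dominates_power hXN (fun=> m0) hU1 dN ht u; rewrite wsq1.
  by rewrite scalerN -scaleNr rmorphN.
have mt : m `^ t = cos alpha `^ (2 * t) / r `^ t.
  rewrite /m powRM ?exprn_ge0 ?invr_ge0 ?(ltW c0) ?(ltW r0) //.
  by rewrite -powR_inv1 ?(ltW r0) // -powRrM mulN1r powRN powRrM powR_mulrn ?(ltW c0).
have qrt : cmod q `^ t * r `^ t <= wq q A `^ t.
  rewrite -powRM ?(ltW q0) ?(ltW r0) //; apply: ge0_ler_powR; rewrite ?nnegrE ?(ltW w0) //.
  by rewrite mulr_ge0 ?(ltW q0) ?(ltW r0).
have q1t : cmod q `^ (t + 1) = cmod q `^ t * cmod q.
  by rewrite powRD ?(gt_eqF q0) ?implybT // powRr1 ?(ltW q0).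
have qt0 : 0 < cmod q `^ t by exact: powR_gt0.
have rt0 : 0 < r `^ t by exact: powR_gt0.
have wt0 : 0 < wq q A `^ t by exact: powR_gt0.
have ct0 : 0 < cos (t * alpha).
  apply: cos_gt0_pihalf; apply/andP; split.
    by rewrite (lt_le_trans (y := 0)) ?mulr_ge0 // oppr_lt0 divr_gt0 ?pi_gt0.
  by rewrite (le_lt_trans _ a1) // ler_piMl.
have c2t : 0 < cos alpha `^ (2 * t) by exact: powR_gt0.
have cV : (cos alpha)^-1 `^ (2 * t) = (cos alpha `^ (2 * t))^-1.
  by rewrite -[(cos alpha)^-1]powR_inv1 ?(ltW c0) // -powRrM mulN1r powRN.
have cwt : cos alpha `^ t * wq q A `^ t <= r `^ t.
  rewrite -powRM ?(ltW c0) ?(ltW w0) //; apply: ge0_ler_powR; rewrite ?nnegrE ?(ltW r0) //.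
  by rewrite mulr_ge0 ?(ltW c0) ?(ltW w0).
have ST : mexp ((- t)%:C *: X) *m mexp (t%:C *: X) = 1%:M.
  have -> : (- t)%:C *: X = - (t%:C *: X) by rewrite rmorphN scaleNr.
  by rewrite -[X in _ *m mexp X = _]opprK mexpNK.
have lowt : cmod q * r `^ t <= wq q (mexp (t%:C *: X)).
  apply: le_trans (wq_ge hn q1 _ x0u); rewrite ler_pM2l //.
  exact: le_trans low (reform_le_cmod _ _).
(* A^t is bounded as the inverse of A^-t, whose real part is at least m^t. *)
have upt : wq q (mexp (t%:C *: X)) <= (m `^ t)^-1.
  apply: (wq_le hn q1) => x y xu yu.
  exact: (accretive_inverse_bound (powR_gt0 _ m0) ST dNt xu yu).
have lowNt : cmod q * m `^ t <= wq q (mexp ((- t)%:C *: X)).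
  have [y yu] := exists_unitv hn.
  apply: le_trans (wq_ge hn q1 _ yu); rewrite ler_pM2l //.
  apply: le_trans (reform_le_cmod _ _); apply: le_trans (dNt y).
  by rewrite (proj1 (unitvE y) yu) mulr1.
rewrite q1t cV powRN; rewrite mt in upt lowNt.
exact: (radius_arithmetic q0 qrt cwt c2t ct0 (cos_le1 _) wt0 rt0 qt0 lowt upt lowNt).
Qed.
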